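(* Consider the system $x_{t+1}=Ax_t+Bu_t+w_t$, $y_t=Cx_t+v_t$, $t=0,1,2,\dots$, with $x_0\sim\mathcal N(0,\Sigma_{x_0})$, $w_t\sim\mathcal N(0,\Sigma_w)$, $v_t\sim\mathcal N(0,\Sigma_v)$, where $x_0,(w_t)_t,(v_t)_t$ are mutually independent and $\Sigma_w>0$, $\Sigma_v>0$, and where the input $u_t=g_t(\mathcal Y_t)$ is a measurable deterministic function of the outputs $y_0,\dots,y_t$. Then $f(x_t\mid\mathcal Y_t)$ and $f(x_{t+1}\mid\mathcal Y_t)$ are the probability densities of Gaussian distributions $\mathcal N(\hat x_{t|t},P_{t|t})$ and $\mathcal N(\hat x_{t+1|t},P_{t+1|t})$, respectively, with $P_{t|t}>0$ and $P_{t+1|t}>0$. For $t=0,1,2,\dots$ their conditional means and covariances can be computed iteratively as follows: $$\hat x_{t+1|t+1}=\hat x_{t+1|t}+P_{t+1|t}C^{\mathsf T}(CP_{t+1|t}C^{\mathsf T}+\Sigma_v)^{-1}(y_{t+1}-C\hat x_{t+1|t}),$$ $$P_{t+1|t+1}=P_{t+1|t}-P_{t+1|t}C^{\mathsf T}(CP_{t+1|t}C^{\mathsf T}+\Sigma_v)^{-1}CP_{t+1|t},$$ where $$\hat x_{t+1|t}=A\hat x_{t|t}+Bg_t(\mathcal Y_t),\qquad P_{t+1|t}=AP_{t|t}A^{\mathsf T}+\Sigma_w .$$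
   Context: Here $x_t\in\mathbb R^n$, $u_t\in\mathbb R^m$, $y_t\in\mathbb R^p$, and $A,B,C$ are known real matrices of compatible dimensions. $\mathcal Y_t=\{y_0,\dots,y_t\}$ denotes the outputs up to time $t$ (or, more precisely, the $\sigma$-algebra they generate), $\mathbb E_{\mathcal Y_s}$ is conditional expectation given $\mathcal Y_s$, and $f(x_t\mid\mathcal Y_s)$ is the conditional density of $x_t$ given $\mathcal Y_s$. For all $t,s$: $\hat x_{t|s}=\mathbb E_{\mathcal Y_s}[x_t]$ and $P_{t|s}=\mathbb E_{\mathcal Y_s}[(x_t-\hat x_{t|s})(x_t-\hat x_{t|s})^{\mathsf T}]$. The recursion is initialized with $\hat x_{0|-1}=0$ and $P_{0|-1}=\Sigma_{x_0}$ (the law of $x_0$ before any measurement), and $\hat x_{0|0},P_{0|0}$ are obtained from these by the measurement-update formulas (the first two displayed formulas with $t=-1$). ''$>0$'' for symmetric matrices means positive definite.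
   Formalization: At t = 0 the claims that f(x_0|Y_0) is a Gaussian density and P_{0|0} > 0 are stated only for Σ_{x_0} > 0, since they fail when Σ_{x_0} is singular (for example Σ_{x_0} = 0). *)

(* Defs.v *)
From HB Require Import structures.
From mathcomp Require Import all_boot all_order all_algebra.
From mathcomp Require Import all_classical all_reals all_analysis.

Set Implicit Arguments.
Unset Strict Implicit.
Unset Printing Implicit Defensive.
Import Order.TTheory GRing.Theory Num.Theory.
Import numFieldNormedType.Exports.

Local Open Scope classical_set_scope.
Local Open Scope ring_scope.

(* The Borel sigma-algebra on R^(m x n), generated by the coordinate maps. *)
Section measurable_matrix.
Context {R : realType} (m n : nat).

Definition matrix_measurable : set (set 'M[R]_(m, n)) :=
  <<s \bigcup_ij preimage_set_system setT 
    (fun M : 'M[R]_(m, n) => M ij.1 ij.2) measurable >>.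

Let matrix_set0 : matrix_measurable set0.
Proof. exact: sigma_algebra0. Qed.

Let matrix_setC A : matrix_measurable A -> matrix_measurable (~` A).
Proof. exact: sigma_algebraC. Qed.

Let matrix_bigcup (F : (set 'M[R]_(m, n))^nat) :
  (forall i, matrix_measurable (F i)) -> matrix_measurable (\bigcup_i F i).
Proof. exact: sigma_algebra_bigcup. Qed.

HB.instance Definition _ := @isMeasurable.Build default_measure_display
  'M[R]_(m, n) matrix_measurable matrix_set0 matrix_setC matrix_bigcup.

End measurable_matrix.

Section measurable_matrix_lemmas.
Context {R : realType} (m n : nat).

Lemma measurable_matrix_coord i j :
  measurable_fun setT (fun M : 'M[R]_(m, n) => M i j).
Proof.
move=> _ B mB; apply: sub_sigma_algebra; exists (i, j) => //.
by exists B.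
Qed.

Lemma measurable_fun_matrixP d (T : measurableType d) (f : T -> 'M[R]_(m, n)) :
  measurable_fun setT f <-> forall i j, measurable_fun setT (fun x => f x i j).
Proof.
split=> [mf i j|mf].
  exact: (measurableT_comp (measurable_matrix_coord i j) mf).
move=> _ A mA; rewrite setTI.
suff H : (@matrix_measurable R m n) `<=` [set B | measurable (f @^-1` B)].
  exact: H _ mA.
apply: smallest_sub.
  split => /=.
  - by rewrite preimage_set0.
  - by move=> B mB; rewrite setTD preimage_setC; exact: measurableC.
  - by move=> F mF; rewrite preimage_bigcup; exact: bigcup_measurable.
move=> _ [[i j] _ [B mB <-]] /=; rewrite setTI.
by have := mf i j measurableT B mB; rewrite setTI.
Qed.

End measurable_matrix_lemmas.

(* Lebesgue measure on R^n = 'cV[R]_n: the n-fold product of the Lebesgue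
   measure on R, transported along R * R^n ~ R^n.+1. *)
Section lebesgue_cV.
Context {R : realType}.

Definition consV n (q : measurableTypeR R * 'cV[R]_n) : 'cV[R]_n.+1 :=
  \col_i oapp (fun k => q.2 k 0) q.1 (unlift ord0 i).

Definition unconsV n (v : 'cV[R]_n.+1) : measurableTypeR R * 'cV[R]_n :=
  (v ord0 0, \col_i v (lift ord0 i) 0).

Lemma consVK n : cancel (@consV n) (@unconsV n).
Proof.
move=> [a v]; congr pair; first by rewrite mxE unlift_none.
by apply/colP => i; rewrite !mxE liftK.
Qed.

Lemma measurable_consV n : measurable_fun setT (@consV n).
Proof.
apply/measurable_fun_matrixP => i j.
under eq_fun do rewrite mxE.
case: (unliftP ord0 i) => [k|] _ /=; last exact: measurable_fst.
apply: (@measurableT_comp _ _ _ _ _ _ (fun v : 'cV[R]_n => v k 0)) => //.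
exact: measurable_matrix_coord.
Qed.

Lemma measurable_unconsV n : measurable_fun setT (@unconsV n).
Proof.
apply/measurable_fun_pairP; split => /=; first exact: measurable_matrix_coord.
apply/measurable_fun_matrixP => i j.
by under eq_fun do rewrite mxE; exact: measurable_matrix_coord.
Qed.

Section step.
Variables (n : nat) (mu : {sigma_finite_measure set 'cV[R]_n -> \bar R}).

Definition lebesgue_consV : set 'cV[R]_n.+1 -> \bar R :=
  pushforward (@lebesgue_measure R \x mu)%E (@consV n).

HB.instance Definition _ := Measure.copy lebesgue_consV
  (measure_function_pushforward__canonical__measure_function_Measure
     (@lebesgue_measure R \x mu)%E (@measurable_consV n)).

Let lebesgue_consV_sigma_finite : sigma_finite setT lebesgue_consV.
Proof.
have /sigma_finiteP[F [FT ndF Foo]] := sigma_finiteT (@lebesgue_measure R).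
have /sigma_finiteP[G [GT ndG Goo]] := sigma_finiteT mu.
exists (fun k => @unconsV n @^-1` (F k `*` G k)).
  rewrite -preimage_bigcup; apply/esym; rewrite -[RHS](preimage_setT (@unconsV n)).
  congr (_ @^-1` _); rewrite -subTset => -[a b] _.
  have [i _ Fi] : (\bigcup_i F i) a by rewrite -FT.
  have [j _ Gj] : (\bigcup_i G i) b by rewrite -GT.
  exists (maxn i j) => //; split.
  - by move: Fi; exact/subsetPset/ndF/leq_maxl.
  - by move: Gj; exact/subsetPset/ndG/leq_maxr.
move=> k; have [mF Fk] := Foo k; have [mG Gk] := Goo k; split.
  rewrite -[X in measurable X]setTI; apply: measurable_unconsV => //.
  exact: measurableX.
rewrite /lebesgue_consV /pushforward -comp_preimage.
rewrite (_ : @unconsV n \o @consV n = id); last exact/funext/consVK.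
by rewrite preimage_id product_measure1E// lte_mul_pinfty// ge0_fin_numE.
Qed.

HB.instance Definition _ := Measure_isSigmaFinite.Build _ _ _ lebesgue_consV
  lebesgue_consV_sigma_finite.

End step.

Fixpoint lebesgue_cV n : {sigma_finite_measure set 'cV[R]_n -> \bar R} :=
  match n with
  | 0 => dirac (0 : 'cV[R]_0)
  | n.+1 => lebesgue_consV (lebesgue_cV n)
  end.

End lebesgue_cV.

Section gaussian.
Context {R : realType}.

Definition posdef n (M : 'M[R]_n) :=
  M^T = M /\ forall z : 'cV[R]_n, z != 0 -> 0 < (z^T *m M *m z) 0 0.

Definition gaussian_pdf n (mu : 'cV[R]_n) (Sigma : 'M[R]_n) (z : 'cV[R]_n) : R :=
  expR (- ((z - mu)^T *m invmx Sigma *m (z - mu)) 0 0 / 2)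
    / Num.sqrt ((2 * pi) ^+ n * \det Sigma).

(* X ~ N(mu, Sigma), also for singular Sigma: X has the law of mu + S Z, where
   S S^T = Sigma and Z is a standard Gaussian vector. *)
Definition gaussian_law d (T : measurableType d) (P : probability T R) n
    (X : T -> 'cV[R]_n) (mu : 'cV[R]_n) (Sigma : 'M[R]_n) :=
  exists2 S : 'M[R]_n, S *m S^T = Sigma &
    forall A, measurable A ->
      P (X @^-1` A) = (\int[lebesgue_cV n]_(z in [set z | A (mu + S *m z)%R])
                          (gaussian_pdf 0 1%:M z)%:E)%E.

End gaussian.

Definition mutually_independent d (T : measurableType d) (R : realType)
    (P : probability T R) (I : eqType) (F : I -> set (set T)) :=
  forall (s : seq I) (E : I -> set T), uniq s ->
    (forall i, i \in s -> F i (E i)) ->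
    P (\bigcap_(i in [set` s]) E i) = (\prod_(i <- s) P (E i))%E.

Section conditional.
Context d (T : measurableType d) (R : realType) (P : probability T R).
Context d' (T' : measurableType d').
Implicit Types (Y : T -> T') (X Z : T -> R).

(* Z is a version of E[X | Y] for X >= 0, possibly of infinite mean. *)
Definition is_condE_ge0 Y X Z :=
  [/\ measurable_fun setT (Z : g_sigma_algebra_preimageType Y -> R),
      forall w, 0 <= Z w &
      forall B, measurable B ->
        (\int[P]_(w in Y @^-1` B) (Z w)%:E =
         \int[P]_(w in Y @^-1` B) (X w)%:E)%E].

(* E[X | Y] = E[X^+ | Y] - E[X^- | Y], both terms being finite. This is the
   usual conditional expectation when X is integrable; integrability cannot be
   assumed here, as the feedback law is an arbitrary measurable function. *)
Definition is_condE Y X Z :=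
  exists Zp Zn, [/\ is_condE_ge0 Y X^\+ Zp, is_condE_ge0 Y X^\- Zn & Z = Zp \- Zn].

Definition has_condE Y X := exists Z, is_condE Y X Z.

(* A version of E[X | Y]; meaningful only if has_condE Y X. *)
Definition condE Y X : T -> R := xget (cst 0) [set Z | is_condE Y X Z].

Section vector.
Variable n : nat.
Implicit Type V : T -> 'cV[R]_n.

Definition cond_mean Y V (w : T) : 'cV[R]_n :=
  \col_i condE Y (fun w' => V w' i 0) w.

Definition cond_dev Y V (i j : 'I_n) (w : T) : R :=
  (V w i 0 - cond_mean Y V w i 0) * (V w j 0 - cond_mean Y V w j 0).

Definition cond_cov Y V (w : T) : 'M[R]_n :=
  \matrix_(i, j) condE Y (cond_dev Y V i j) w.

Definition has_cond_moments Y V :=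
  (forall i, has_condE Y (fun w => V w i 0)) /\
  (forall i j, has_condE Y (cond_dev Y V i j)).

Definition cond_density Y V (f : T -> 'cV[R]_n -> R) :=
  [/\ measurable_fun setT
        (fun q : g_sigma_algebra_preimageType Y * 'cV[R]_n => f q.1 q.2),
      forall w z, 0 <= f w z &
      forall A B, measurable A -> measurable B ->
        (P (V @^-1` A `&` Y @^-1` B) =
         \int[P]_(w in Y @^-1` B) \int[lebesgue_cV n]_(z in A) (f w z)%:E)%E].

End vector.
End conditional.

Section kalman.
Context {R : realType} (n p : nat).

(* (y_0, ..., y_t), as the columns of a matrix. *)
Definition outputs T (y : nat -> T -> 'cV[R]_p) t (w : T) : 'M[R]_(p, t.+1) :=
  \matrix_(i, k) y k w i 0.

Definition noise_sigma_algebra q (T : pointedType) (x0 : T -> 'cV[R]_n)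
    (w : nat -> T -> 'cV[R]_n) (v : nat -> T -> 'cV[R]_q)
    (i : unit + (nat + nat)) : set (set T) :=
  match i with
  | inl _ => g_sigma_algebra_preimage x0
  | inr (inl t) => g_sigma_algebra_preimage (w t)
  | inr (inr t) => g_sigma_algebra_preimage (v t)
  end.

Definition update_mean (C : 'M[R]_(p, n)) (Sv : 'M[R]_p) (xm : 'cV[R]_n)
    (Pm : 'M[R]_n) (y : 'cV[R]_p) : 'cV[R]_n :=
  xm + Pm *m C^T *m invmx (C *m Pm *m C^T + Sv) *m (y - C *m xm).

Definition update_cov (C : 'M[R]_(p, n)) (Sv : 'M[R]_p) (Pm : 'M[R]_n) : 'M[R]_n :=
  Pm - Pm *m C^T *m invmx (C *m Pm *m C^T + Sv) *m C *m Pm.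

End kalman.

(* Main.v *)
Require Import Defs.
From HB Require Import structures.
From mathcomp Require Import all_boot all_order all_algebra.
From mathcomp Require Import all_classical all_reals all_analysis.
From mathcomp Require Import measurable_realfun ring lra.

Set Implicit Arguments.
Unset Strict Implicit.
Unset Printing Implicit Defensive.
Import Order.TTheory GRing.Theory Num.Theory.
Import numFieldNormedType.Exports.

Local Open Scope classical_set_scope.
Local Open Scope ring_scope.

(** Write Y for the outputs observed so far and x for a state.  The proof keeps
    the state in the form x = m(Y) + e, an identity between functions, where m
    is the measurable function computed by the recursion of the statement, and
    the error e is independent of Y and distributed as M Z, with Z a
    standard Gaussian vector and M M^T = Sigma.  This is [gaussian_residual].
    The feedback is a function of Y, so it only changes m, and e evolves as if
    there were no control.  For the same reason conditional moments make sense
    even when the control law makes the state non-integrable.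

    The form is preserved by both steps.  After a transition the error is
    A e + w, and w is independent of (Y, e) ([time_update]).  A measurement
    reveals the innovation nu = C e + v.  The gain K is chosen so that
    e - K nu and nu, which are linear images of one standard Gaussian vector,
    are uncorrelated; they are then independent ([gauss_indep]), and since
    (Y, y) is a function of (Y, nu), the new error e - K nu is independent of
    all outputs ([measurement_update]).  That each noise is independent of
    what precedes it follows from mutual independence by a pi-lambda argument
    ([mutually_independent_join]).

    The form yields the theorem.  By Fubini, the conditional expectation of
    F(Y, e) given Y is the integral of F(Y, M z) over the standard Gaussian
    law ([is_condE_residual]); versions agree almost everywhere
    ([is_condE_unique]); so the conditional mean is m(Y) and the conditional
    covariance is Sigma.  When Sigma is positive definite, m(Y) + M Z has the
    density [gaussian_pdf] ([integral_gaussian_pdf]).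

    All Gaussian facts rest on the invariance of the standard Gaussian law
    under orthogonal maps ([gauss_orthogonal]), which comes from the
    uniqueness of translation-invariant measures.  It implies that W Z is
    standard as soon as W W^T = 1 ([gauss_coisometry]), hence that the law of
    M Z depends on M M^T only and that uncorrelated means independent. *)

(** * Measurability of matrix operations *)

Lemma measurable_preimage d d' (T : measurableType d) (T' : measurableType d')
    (f : T -> T') (A : set T') :
  measurable_fun setT f -> measurable A -> measurable (f @^-1` A).
Proof. by move=> mf mA; rewrite -[X in measurable X]setTI; exact: mf. Qed.

(** Real powers are measurable, and this expression of the inverse through them
    remains correct at 0. *)
Lemma measurable_inv {R : realType} : measurable_fun setT (@GRing.inv R).
Proof.
rewrite (_ : GRing.inv = fun x => x * (x ^+ 2) `^ (- 1)); last first.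
  apply/funext => x /=; rewrite powR_inv1 ?sqr_ge0//.
  have [->|x0] := eqVneq x 0; first by rewrite invr0 mul0r.
  by rewrite expr2 invfM mulrA divff// mul1r.
apply: measurable_funM => //; apply: (measurableT_comp (measurable_powR (- 1))).
exact: measurable_funX.
Qed.

Section measurable_matrix_ops.
Context {R : realType} d (T : measurableType d).

Lemma measurable_mulmx m n p (f : T -> 'M[R]_(m, n)) (g : T -> 'M[R]_(n, p)) :
  measurable_fun setT f -> measurable_fun setT g ->
  measurable_fun setT (fun x => f x *m g x).
Proof.
move=> /measurable_fun_matrixP mf /measurable_fun_matrixP mg.
apply/measurable_fun_matrixP => i j; under eq_fun do rewrite mxE.
by apply: measurable_sum => k; exact: measurable_funM.
Qed.

Lemma measurable_mulmxl m n p (M : 'M[R]_(m, n)) (g : T -> 'M[R]_(n, p)) :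
  measurable_fun setT g -> measurable_fun setT (fun x => M *m g x).
Proof. by move=> mg; apply: measurable_mulmx. Qed.

Lemma measurable_mxD m n (f g : T -> 'M[R]_(m, n)) :
  measurable_fun setT f -> measurable_fun setT g ->
  measurable_fun setT (fun x => f x + g x).
Proof.
move=> /measurable_fun_matrixP mf /measurable_fun_matrixP mg.
apply/measurable_fun_matrixP => i j; under eq_fun do rewrite mxE.
exact: measurable_funD.
Qed.

Lemma measurable_mxN m n (f : T -> 'M[R]_(m, n)) :
  measurable_fun setT f -> measurable_fun setT (fun x => - f x).
Proof.
move=> /measurable_fun_matrixP mf.
apply/measurable_fun_matrixP => i j; under eq_fun do rewrite mxE.
exact: measurableT_comp.
Qed.

Lemma measurable_mxB m n (f g : T -> 'M[R]_(m, n)) :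
  measurable_fun setT f -> measurable_fun setT g ->
  measurable_fun setT (fun x => f x - g x).
Proof. by move=> mf mg; apply: measurable_mxD => //; exact: measurable_mxN. Qed.

Lemma measurable_trmx m n (f : T -> 'M[R]_(m, n)) :
  measurable_fun setT f -> measurable_fun setT (fun x => (f x)^T).
Proof.
move=> /measurable_fun_matrixP mf.
by apply/measurable_fun_matrixP => i j; under eq_fun do rewrite mxE; exact: mf.
Qed.

Lemma measurable_determinant n (f : T -> 'M[R]_n) :
  measurable_fun setT f -> measurable_fun setT (fun x => \det (f x)).
Proof.
move=> /measurable_fun_matrixP mf; rewrite /determinant.
apply: measurable_sum => s; apply: measurable_funM => //.
exact: measurable_prod.
Qed.

Lemma measurable_invmx n (f : T -> 'M[R]_n) :
  measurable_fun setT f -> measurable_fun setT (fun x => invmx (f x)).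
Proof.
move=> mf; have mdet := measurable_determinant mf.
have /measurable_fun_matrixP mf' := mf.
apply/measurable_fun_matrixP => i j.
rewrite (_ : (fun x => _) = (fun x => if \det (f x) == 0 then f x i j
   else (\det (f x))^-1 * cofactor (f x) j i)); last first.
  apply/funext => x; rewrite /invmx unitmxE unitfE.
  by case: eqP => //= _; rewrite !mxE.
apply: measurable_fun_ifT => //; first exact: measurable_fun_eqr.
apply: measurable_funM; first exact: (measurableT_comp measurable_inv).
apply: measurable_funM => //; apply: measurable_determinant.
by apply/measurable_fun_matrixP => k l; under eq_fun do rewrite !mxE; exact: mf'.
Qed.

Lemma measurable_usubmx k l (f : T -> 'cV[R]_(k + l)) :
  measurable_fun setT f -> measurable_fun setT (fun x => usubmx (f x)).
Proof.
move=> /measurable_fun_matrixP mf.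
by apply/measurable_fun_matrixP => i j; under eq_fun do rewrite mxE; exact: mf.
Qed.

Lemma measurable_dsubmx k l (f : T -> 'cV[R]_(k + l)) :
  measurable_fun setT f -> measurable_fun setT (fun x => dsubmx (f x)).
Proof.
move=> /measurable_fun_matrixP mf.
by apply/measurable_fun_matrixP => i j; under eq_fun do rewrite mxE; exact: mf.
Qed.

End measurable_matrix_ops.

Lemma measurable_gaussian_pdf {R : realType} d (T : measurableType d) n
    (m : T -> 'cV[R]_n) (S : T -> 'M[R]_n) (z : T -> 'cV[R]_n) :
  measurable_fun setT m -> measurable_fun setT S -> measurable_fun setT z ->
  measurable_fun setT (fun x => gaussian_pdf (m x) (S x) (z x)).
Proof.
move=> mm mS mz; have mzm := measurable_mxB mz mm.
rewrite /gaussian_pdf; apply: measurable_funM.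
  apply: measurableT_comp => //; apply: measurable_funM => //.
  apply: measurable_funN.
  set q := fun x => (z x - m x)^T *m invmx (S x) *m (z x - m x).
  have mq : measurable_fun setT q.
    apply: measurable_mulmx => //; apply: measurable_mulmx.
      exact: measurable_trmx.
    exact: measurable_invmx.
  by have /measurable_fun_matrixP := mq; exact.
apply: (measurableT_comp measurable_inv).
apply: (measurableT_comp (continuous_measurable_fun (@sqrt_continuous R))).
by apply: measurable_funM => //; exact: measurable_determinant.
Qed.

(** * Integration against densities and Lebesgue measure on column vectors *)

Lemma measurable_patch d (T : measurableType d) (R : realType) (A : set T)
    (f : T -> \bar R) :
  measurable A -> measurable_fun setT f -> measurable_fun setT (f \_ A).
Proof.
by move=> mA mf; apply/(measurable_restrictT f mA); apply: measurable_funTS.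
Qed.

Section density.
Context d (T : measurableType d) (R : realType).
Variables (mu nu : {measure set T -> \bar R}) (h : T -> R).
Hypotheses (mh : measurable_fun setT h) (h0 : forall x, 0 <= h x).
Hypothesis nuE : forall A, measurable A -> nu A = (\int[mu]_(x in A) (h x)%:E)%E.
Local Open Scope ereal_scope.
Import HBNNSimple.

(** The hypothesis is the case of indicators; nonnegative functions are increasing
    limits of combinations of these. *)
Lemma ge0_integral_density (f : T -> \bar R) : measurable_fun setT f ->
  (forall x, 0 <= f x) -> \int[nu]_x f x = \int[mu]_x (f x * (h x)%:E).
Proof.
move=> mf f0; have mH : measurable_fun setT (EFin \o h) by exact/measurable_EFinP.
pose f_ := nnsfun_approx measurableT mf.
have cf x : (f_ n x)%:E @[n --> \oo] --> f x.
  by apply: cvg_nnsfun_approx => //.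
have ndf x : {homo (fun n => (f_ n x)%:E) : n m / (n <= m)%N >-> n <= m}.
  by move=> n m nm; rewrite lee_fin; exact/lefP/nd_nnsfun_approx.
transitivity (limn (fun n => \int[nu]_x (f_ n x)%:E)).
  rewrite -monotone_convergence//.
  - by apply: eq_integral => y _; apply/esym/cvg_lim => //; exact: cf.
  - by move=> n; exact/measurable_EFinP/measurable_funP.
  - by move=> n y _; rewrite lee_fin.
transitivity (limn (fun n => \int[mu]_x ((f_ n x)%:E * (h x)%:E))); last first.
  rewrite -monotone_convergence//.
  - apply: eq_integral => y _; apply/cvg_lim => //.
    by apply: cvgeZr => //; exact: cf.
  - by move=> n; apply: emeasurable_funM => //; exact/measurable_EFinP.
  - by move=> n y _; rewrite mule_ge0// lee_fin.
  - by move=> y _ m n mn; rewrite lee_wpmul2r ?lee_fin//; exact: ndf.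
congr (limn _); apply/funext => n.
under eq_integral do rewrite fimfunE -fsumEFin//.
rewrite ge0_integral_fsum//; last 2 first.
- by move=> r; exact/measurable_EFinP/measurable_funM.
- by move=> r x _; rewrite nnfun_muleindic_ge0.
under [RHS]eq_integral => x _.
  rewrite fimfunE -fsumEFin// ge0_mule_fsuml; last first.
    by move=> r; rewrite nnfun_muleindic_ge0.
  over.
rewrite ge0_integral_fsum//; last 2 first.
- move=> r; apply: (eq_measurable_fun
    (fun x => (r * \1_(f_ n @^-1` [set r]) x * h x)%:E)) => [x _|].
    by rewrite EFinM.
  by apply/measurable_EFinP/measurable_funM => //; exact: measurable_funM.
- by move=> r x _; rewrite mule_ge0 ?nnfun_muleindic_ge0 ?lee_fin.
apply: eq_fsbigr => r _; rewrite integralZl_indic_nnsfun// integral_indic//=.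
rewrite setIT nuE//.
under [RHS]eq_integral do rewrite EFinM -muleA.
have [r0|r0] := leP 0%R r; last first.
  rewrite preimage_nnfun0// integral_set0 mule0.
  by apply/esym/integral0_eq => x _; rewrite indic0 mul0e mule0.
rewrite ge0_integralZl//; last 2 first.
- apply: (eq_measurable_fun (fun x => (\1_(f_ n @^-1` [set r]) x * h x)%:E)) => [x _|].
    by rewrite EFinM.
  by apply/measurable_EFinP/measurable_funM.
- by move=> x _; rewrite mule_ge0// lee_fin.
congr *%E; rewrite integral_mkcond; apply: eq_integral => x _.
by rewrite patchE indicE; case: ifPn => _; rewrite ?mul1e ?mul0e.
Qed.

End density.

Section lebesgue_cV_theory.
Context {R : realType}.
Local Notation leb := (@lebesgue_measure R).
Local Open Scope ereal_scope.

Lemma measurable_addr (a : R) : measurable_fun setT (fun x : measurableTypeR R =>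
  (x + a)%R : measurableTypeR R).
Proof. exact: measurable_funD. Qed.

(** A translate of the Lebesgue measure gives every interval its length, which
    characterizes it. *)
Lemma ge0_integral_lebesgueD (f : measurableTypeR R -> \bar R) (a : R) :
  measurable_fun setT f -> (forall x, 0 <= f x) ->
  \int[leb]_x f (x + a)%R = \int[leb]_x f x.
Proof.
move=> mf f0.
pose nu : {measure set (measurableTypeR R) -> \bar R} :=
  measure_function_pushforward__canonical__measure_function_Measure
     leb (measurable_addr a).
have nuE A : measurable A -> leb A = nu A.
  apply: lebesgue_measure_unique => _ [[b c] _ <-].
  rewrite /nu /= /pushforward.
  rewrite [X in _ = lebesgue_measure X](_ : _ = `](b - a)%R, (c - a)%R]%classic).
    rewrite !lebesgue_measure_itv/= !lte_fin ltrD2r -!EFinB.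
    by rewrite (_ : (c - a - (b - a) = c - b)%R)//; ring.
  by apply/seteqP; split => x /=; rewrite !in_itv/= ltrBlDr lerBrDr.
transitivity (\int[nu]_x f x); last first.
  by apply: eq_measure_integral => A mA _; exact/esym/nuE.
by rewrite [RHS] ge0_integral_pushforward//; exact: measurable_addr.
Qed.

Lemma ge0_integral_lebesgue_cVS n (f : 'cV[R]_n.+1 -> \bar R) :
  measurable_fun setT f -> (forall z, 0 <= f z) ->
  \int[lebesgue_cV n.+1]_z f z =
  \int[leb]_a \int[lebesgue_cV n]_z f (consV (a, z)).
Proof.
move=> mf f0.
rewrite [LHS](@ge0_integral_pushforward _ _ _ _ _ _ (@measurable_consV R n)
  (leb \x lebesgue_cV n)%E setT f)//.
rewrite preimage_setT fubini_tonelli1//.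
  exact: measurableT_comp mf (@measurable_consV R n).
by move=> x; exact: f0.
Qed.

Lemma ge0_integral_lebesgue_cV0 (f : 'cV[R]_0 -> \bar R) :
  measurable_fun setT f -> (forall z, 0 <= f z) ->
  \int[lebesgue_cV 0]_z f z = f 0%R.
Proof. by move=> mf f0; rewrite [LHS]integral_dirac ?diracT ?mul1e. Qed.

Lemma consVD n (a b : R) (y z : 'cV[R]_n) :
  (consV (a, y) + consV (b, z) = consV (a + b, y + z))%R.
Proof. by apply/colP => i; rewrite !mxE; case: unliftP => //= j _; rewrite mxE. Qed.

Lemma consV_exists n (z : 'cV[R]_n.+1) : exists a y, z = consV (a, y).
Proof.
exists (z ord0 ord0), (\col_i z (lift ord0 i) ord0)%R.
by apply/colP => i; rewrite !mxE; case: unliftP => [j|] -> /=; rewrite ?mxE.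
Qed.

(** Tonelli reduces the translation to one coordinate at a time. *)
Lemma ge0_integral_lebesgue_cVD n (f : 'cV[R]_n -> \bar R) (v : 'cV[R]_n) :
  measurable_fun setT f -> (forall x, 0 <= f x) ->
  \int[lebesgue_cV n]_z f (z + v)%R = \int[lebesgue_cV n]_z f z.
Proof.
elim: n f v => [|n ih] f v mf f0.
  by apply: eq_integral => z _; congr f; apply/colP => -[].
have mconsV T1 (d1 : measure_display) (T2 : measurableType d1) (g : T2 -> measurableTypeR R)
    (h : T2 -> 'cV[R]_n) : measurable_fun setT g -> measurable_fun setT h ->
  measurable_fun setT (fun x => f (consV (g x, h x))).
  move=> mg mh; apply: (measurableT_comp mf).
  apply: (measurableT_comp (@measurable_consV R n)).
  exact: measurable_fun_pair.
have [a [w ->]] := consV_exists v.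
rewrite !ge0_integral_lebesgue_cVS//; last first.
  by apply: (measurableT_comp mf); exact: measurable_mxD.
under eq_integral do under eq_integral do rewrite consVD.
under eq_integral => b _.
  rewrite (ih (fun y => f (consV (b + a, y)%R)))//; last exact: mconsV.
  over.
rewrite (@ge0_integral_lebesgueD (fun b => \int[lebesgue_cV n]_z f (consV (b, z))))//.
  apply: (measurable_fun_fubini_tonelli_F (fun q => f (consV q))) => //.
  exact: measurableT_comp mf (@measurable_consV R n).
by move=> b; exact: integral_ge0.
Qed.

End lebesgue_cV_theory.

(** * The standard Gaussian measure *)

Section standard_gaussian.
Context {R : realType}.
Local Notation leb := (@lebesgue_measure R).
Local Notation phi := (gaussian_pdf 0 1%:M).
Local Notation npdf := (normal_pdf (0 : R) 1).
Implicit Types n k l : nat.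

Lemma std_pdfE n (z : 'cV[R]_n) :
  phi z = expR (- (z^T *m z) 0 0 / 2) / Num.sqrt ((2 * pi) ^+ n).
Proof. by rewrite /gaussian_pdf subr0 invmx1 mulmx1 det1 mulr1. Qed.

Lemma std_pdf_ge0 n (z : 'cV[R]_n) : 0 <= phi z.
Proof. by rewrite std_pdfE divr_ge0// expR_ge0. Qed.

Lemma measurable_std_pdf n : measurable_fun setT (phi : 'cV[R]_n -> R).
Proof. exact: measurable_gaussian_pdf. Qed.

Lemma std_pdf_orthogonal n (Q : 'M[R]_n) z : Q^T *m Q = 1%:M ->
  phi (Q *m z) = phi z.
Proof. by move=> QQ; rewrite !std_pdfE trmx_mul -mulmxA (mulmxA Q^T) QQ mul1mx. Qed.

Lemma tr_consV_mul n (a b : R) (y z : 'cV[R]_n) :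
  ((consV (a, y))^T *m consV (b, z)) 0 0 = a * b + (y^T *m z) 0 0.
Proof.
rewrite mxE big_ord_recl !mxE unlift_none/=; congr (_ + _).
by apply: eq_bigr => i _; rewrite !mxE liftK.
Qed.

Lemma std_pdf_consV n a (z : 'cV[R]_n) : phi (consV (a, z)) = npdf a * phi z.
Proof.
rewrite !std_pdfE tr_consV_mul normal_pdfE ?oner_eq0// /normal_peak /normal_fun.
rewrite exprS sqrtrM; last by rewrite mulr_ge0// pi_ge0.
rewrite expr1n mul1r subr0 -[pi *+ 2]mulr_natl expr2 invfM opprD mulrDl expRD.
set x := expR _; set y := expR _; set u := Num.sqrt (2 * pi).
set v := Num.sqrt _; ring.
Qed.

Lemma integral_std_pdf n : (\int[@lebesgue_cV R n]_z (phi z)%:E = 1)%E.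
Proof.
have p0 k (z : 'cV[R]_k) : (0 <= (phi z)%:E)%E by rewrite lee_fin std_pdf_ge0.
have mp k : measurable_fun setT (fun z : 'cV[R]_k => (phi z)%:E).
  by apply/measurable_EFinP; exact: measurable_std_pdf.
elim: n => [|n ih].
  rewrite ge0_integral_lebesgue_cV0// std_pdfE mxE big_ord0 oppr0 mul0r expR0.
  by rewrite expr0 sqrtr1 divr1.
rewrite ge0_integral_lebesgue_cVS//.
under eq_integral => a _.
  under eq_integral do rewrite std_pdf_consV EFinM.
  rewrite ge0_integralZl//; [|exact: mp|by rewrite lee_fin normal_pdf_ge0].
  rewrite ih mule1; over.
exact: integral_normal_pdf.
Qed.

(** Defined by its density, the form in which [gaussian_law] uses it; the product
    structure is recovered in [gauss_prod]. *)
Definition gauss n (A : set 'cV[R]_n) : \bar R :=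
  (\int[@lebesgue_cV R n]_(z in A) (phi z)%:E)%E.

Section gauss_measure.
Variable n : nat.

Let gauss0 : gauss (set0 : set 'cV[R]_n) = 0%E.
Proof. exact: integral_set0. Qed.

Let gauss_ge0 (A : set 'cV[R]_n) : (0 <= gauss A)%E.
Proof. by apply: integral_ge0 => z _; rewrite lee_fin std_pdf_ge0. Qed.

Let gauss_semi_sigma_additive : semi_sigma_additive (@gauss n).
Proof.
move=> F mF tF mUF; rewrite /gauss ge0_integral_bigcup//.
- apply: is_cvg_ereal_nneg_natsum_cond => k _ _; exact: gauss_ge0.
- by apply/measurable_EFinP; apply: measurable_funTS; exact: measurable_std_pdf.
- by move=> z _; rewrite lee_fin std_pdf_ge0.
Qed.

HB.instance Definition _ := isMeasure.Build _ _ _ (@gauss n)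
  gauss0 gauss_ge0 gauss_semi_sigma_additive.

Let gauss_setT : gauss [set: 'cV[R]_n] = 1%E.
Proof. exact: integral_std_pdf. Qed.

HB.instance Definition _ := @Measure_isProbability.Build _ _ R (@gauss n)
  gauss_setT.

End gauss_measure.

Local Open Scope ereal_scope.

Lemma ge0_integral_gauss n (f : 'cV[R]_n -> \bar R) :
  measurable_fun setT f -> (forall z, 0 <= f z) ->
  \int[@gauss n]_z f z = \int[@lebesgue_cV R n]_z (f z * (phi z)%:E).
Proof.
move=> mf f0; apply: ge0_integral_density => //.
- exact: measurable_std_pdf.
- exact: std_pdf_ge0.
Qed.

Lemma measurable_consVr n (a : R) : measurable_fun setT (fun z : 'cV[R]_n => consV (a, z)).
Proof. exact: measurableT_comp (@measurable_consV R n) (pair1_measurable a). Qed.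

(** The first coordinate is an independent normal variable, because the density
    factorizes. *)
Lemma gaussS n (A : set 'cV[R]_n.+1) : measurable A ->
  gauss A = \int[leb]_a ((npdf a)%:E * gauss [set z | A (consV (a, z))]).
Proof.
move=> mA; have mphi k : measurable_fun setT (fun z : 'cV[R]_k => (phi z)%:E).
  by apply/measurable_EFinP; exact: measurable_std_pdf.
rewrite /gauss integral_mkcond ge0_integral_lebesgue_cVS//; last 2 first.
- exact: (measurable_patch mA (mphi _)).
- by move=> z; apply: erestrict_ge0 => y _; rewrite lee_fin std_pdf_ge0.
apply: eq_integral => a _; rewrite [in RHS]integral_mkcond.
rewrite -ge0_integralZl//.
- apply: eq_integral => z _; rewrite !patchE.
  rewrite (_ : (z \in _) = (consV (a, z) \in A)); last first.
    by apply/idP/idP; rewrite !inE.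
  by case: ifP => _; rewrite ?mule0// std_pdf_consV EFinM.
- apply: measurable_patch; last exact: mphi.
  exact: (measurable_preimage (measurable_consVr a)).
- by move=> z _; apply: erestrict_ge0 => y _; rewrite lee_fin std_pdf_ge0.
- by rewrite lee_fin normal_pdf_ge0.
Qed.

Lemma measurable_gauss_section n (A : set 'cV[R]_n.+1) : measurable A ->
  measurable_fun setT
    (fun a : measurableTypeR R => gauss [set z : 'cV[R]_n | A (consV (a, z))]).
Proof.
move=> mA.
have := @measurable_fun_xsection _ _ _ _ R (@gauss n) _
  (measurable_preimage (@measurable_consV R n) mA).
apply: eq_measurable_fun => a _ /=; congr gauss.
by apply/seteqP; split => z; rewrite /xsection /= inE.
Qed.

Lemma usubmx_consV k l a (z : 'cV[R]_(k + l)) :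
  @usubmx R k.+1 l 1 (consV (a, z)) = consV (a, usubmx z).
Proof.
apply/colP => i; rewrite mxE !mxE.
case: (unliftP ord0 i) => [j|] ->.
  rewrite (_ : lshift l (lift ord0 j) = lift ord0 (lshift l j)); last exact/val_inj.
  by rewrite liftK /= mxE.
by rewrite (_ : lshift l ord0 = ord0) ?unlift_none //; exact/val_inj.
Qed.

Lemma dsubmx_consV k l a (z : 'cV[R]_(k + l)) :
  @dsubmx R k.+1 l 1 (consV (a, z)) = dsubmx z.
Proof.
apply/colP => i; rewrite !mxE.
by rewrite (_ : rshift k.+1 i = lift ord0 (rshift k i)) ?liftK //; exact/val_inj.
Qed.

Lemma measurable_usub_dsub k l (A : set 'cV[R]_k) (B : set 'cV[R]_l) :
  measurable A -> measurable B ->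
  measurable [set z : 'cV[R]_(k + l) | A (usubmx z) /\ B (dsubmx z)].
Proof.
move=> mA mB; apply: measurableI.
  exact: (measurable_preimage (measurable_usubmx (@measurable_id _ _ setT))).
exact: (measurable_preimage (measurable_dsubmx (@measurable_id _ _ setT))).
Qed.

(** The two halves of a standard Gaussian vector are independent standard Gaussian
    vectors: peel off the coordinates of the first half one by one. *)
Lemma gauss_prod k l (A : set 'cV[R]_k) (B : set 'cV[R]_l) :
  measurable A -> measurable B ->
  gauss [set z : 'cV[R]_(k + l) | A (usubmx z) /\ B (dsubmx z)] =
  gauss A * gauss B.
Proof.
elim: k A => [|k ih] A mA mB.
  rewrite [gauss A](_ : _ = \d_(0%R : 'cV[R]_0) A); last first.
    rewrite /gauss [LHS]integral_mkcond ge0_integral_lebesgue_cV0//; last 2 first.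
    - apply: measurable_patch mA _.
      by apply/measurable_EFinP; exact: measurable_std_pdf.
    - by move=> z; apply: erestrict_ge0 => y _; rewrite lee_fin std_pdf_ge0.
    rewrite patchE diracE std_pdfE mxE big_ord0 oppr0 mul0r expR0.
    by rewrite expr0 sqrtr1 divr1; case: (_ \in _).
  have dE (z : 'cV[R]_(0 + l)) : dsubmx z = z :> 'cV[R]_l.
    by apply/colP => i; rewrite mxE; congr (z _ _); exact/val_inj.
  have uE (z : 'cV[R]_(0 + l)) : usubmx z = 0%R by apply/colP => -[].
  rewrite diracE (_ : [set z | _] = if (0%R : 'cV[R]_0) \in A then B else set0).
    by case: ifP => _; rewrite ?measure0 ?mul0e ?mul1e.
  apply/seteqP; split => z /=; rewrite uE dE.
    by move=> [Az Bz]; rewrite ifT// inE.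
  by case: ifPn => //; rewrite inE.
have mAB := measurable_usub_dsub mA mB.
rewrite (@gaussS (k + l) _ mAB).
rewrite [gauss A]gaussS// -ge0_integralZr//; last 2 first.
- apply: emeasurable_funM; last exact: measurable_gauss_section.
  by apply/measurable_EFinP; exact: measurable_normal_pdf.
- by move=> a _; rewrite mule_ge0// lee_fin normal_pdf_ge0.
apply: eq_integral => a _; rewrite -muleA -ih//; last first.
  exact: (measurable_preimage (measurable_consVr a)).
congr (_ * gauss _); apply/seteqP.
by split => z /=; rewrite usubmx_consV dsubmx_consV.
Qed.

End standard_gaussian.

(** * Rotation invariance and uncorrelated Gaussian vectors *)

Section rotation.
Context {R : realType}.
Local Notation phi := (gaussian_pdf 0 1%:M).
Implicit Types n k l p : nat.
Local Open Scope ereal_scope.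

(** Uniqueness of translation-invariant measures, applied to the Lebesgue measure
    and to its image under Q.  As phi has mass 1, the left-hand side is the double
    integral of f (Q x) * phi y; shift y by Q x, exchange the integrals, shift x
    by - Q^-1 y, exchange again and shift y by Q x: the variables separate. *)
Lemma ge0_integral_lebesgue_cV_mulmx_opp n (Q : 'M[R]_n) (f : 'cV[R]_n -> \bar R) :
  Q \in unitmx -> measurable_fun setT f -> (forall z, 0 <= f z) ->
  \int[lebesgue_cV n]_x f (Q *m x)%R =
  (\int[lebesgue_cV n]_x (phi (Q *m x)%R)%:E) * \int[lebesgue_cV n]_y f (- y)%R.
Proof.
move=> Qu mf f0.
have m1 := @measurable_fst _ _ 'cV[R]_n 'cV[R]_n.
have m2 := @measurable_snd _ _ 'cV[R]_n 'cV[R]_n.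
have mQ d (T : measurableType d) (g : T -> 'cV[R]_n) : measurable_fun setT g ->
  measurable_fun setT (fun x => Q *m g x)%R by exact: measurable_mulmxl.
have mphi d (T : measurableType d) (g : T -> 'cV[R]_n) : measurable_fun setT g ->
    measurable_fun setT (fun x => (phi (g x))%:E).
  by move=> mg; apply/measurable_EFinP/measurableT_comp => //; exact: measurable_std_pdf.
have mfc d (T : measurableType d) (g : T -> 'cV[R]_n) : measurable_fun setT g ->
  measurable_fun setT (fun x => f (g x)) by exact: measurableT_comp.
have p0 (z : 'cV[R]_n) : 0 <= (phi z)%:E by rewrite lee_fin std_pdf_ge0.
have mid := @measurable_id _ 'cV[R]_n setT.
transitivity (\int[lebesgue_cV n]_x \int[lebesgue_cV n]_y
    (f (Q *m x)%R * (phi (y + Q *m x)%R)%:E)).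
  apply: eq_integral => x _.
  rewrite ge0_integralZl//; last first.
    by apply: mphi; apply: measurable_mxD.
  rewrite (ge0_integral_lebesgue_cVD _ (f := fun y => (phi y)%:E))//; last exact: mphi.
  by rewrite integral_std_pdf mule1.
rewrite (fubini_tonelli (fun q : 'cV[R]_n * 'cV[R]_n =>
  f (Q *m q.1)%R * (phi (q.2 + Q *m q.1)%R)%:E))//; last 2 first.
- apply: emeasurable_funM; first by apply: mfc; exact: mQ.
  by apply: mphi; apply: measurable_mxD => //; exact: mQ.
- by move=> q; rewrite mule_ge0.
transitivity (\int[lebesgue_cV n]_y \int[lebesgue_cV n]_x
    (f (Q *m x - y)%R * (phi (Q *m x)%R)%:E)).
  apply: eq_integral => y _.
  apply: etrans _ (ge0_integral_lebesgue_cVD (invmx Q *m y)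
    (f := fun x => f (Q *m x - y)%R * (phi (Q *m x)%R)%:E) _ _).
  - by apply: eq_integral => x _; rewrite mulmxDr mulKVmx// addrK addrC.
  - apply: emeasurable_funM; last by apply: mphi; exact: mQ.
    by apply: mfc; apply: measurable_mxB => //; exact: mQ.
  - by move=> x; rewrite mule_ge0.
rewrite -(fubini_tonelli (fun q : 'cV[R]_n * 'cV[R]_n =>
  f (Q *m q.1 - q.2)%R * (phi (Q *m q.1)%R)%:E))//; last 2 first.
- apply: emeasurable_funM; last by apply: mphi; exact: mQ.
  by apply: mfc; apply: measurable_mxB => //; exact: mQ.
- by move=> q; rewrite mule_ge0.
rewrite -ge0_integralZr//; last 2 first.
- by apply: mphi; exact: mQ.
- by apply: integral_ge0.
apply: eq_integral => x _ /=.
apply: etrans (esym (ge0_integral_lebesgue_cVD (Q *m x)%R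
  (f := fun y => f (Q *m x - y)%R * (phi (Q *m x)%R)%:E) _ _)) _; last first.
- rewrite -ge0_integralZl//; last by apply: mfc; exact: measurable_mxN.
  by apply: eq_integral => y _; rewrite opprD addrCA addrN addr0 muleC.
- by move=> y; rewrite mule_ge0.
- by apply: emeasurable_funM => //; apply: mfc; apply: measurable_mxB.
Qed.

(** The case Q = 1 of the previous lemma removes the reflection.  The constant is
    left as an integral, since it is known without a determinant when Q is
    orthogonal or a Cholesky factor. *)
Lemma ge0_integral_lebesgue_cV_mulmx n (Q : 'M[R]_n) (f : 'cV[R]_n -> \bar R) :
  Q \in unitmx -> measurable_fun setT f -> (forall z, 0 <= f z) ->
  \int[lebesgue_cV n]_x f (Q *m x)%R =
  (\int[lebesgue_cV n]_x (phi (Q *m x)%R)%:E) * \int[lebesgue_cV n]_y f y.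
Proof.
move=> Qu mf f0; rewrite ge0_integral_lebesgue_cV_mulmx_opp//; congr *%E.
have := @ge0_integral_lebesgue_cV_mulmx_opp n 1%:M f (unitmx1 _ _) mf f0.
under eq_integral do rewrite mul1mx.
under [X in X * _]eq_integral do rewrite mul1mx.
by rewrite integral_std_pdf mul1e.
Qed.

(** The density only depends on the norm, so the constant of
    [ge0_integral_lebesgue_cV_mulmx] is the total mass 1. *)
Lemma gauss_orthogonal n (Q : 'M[R]_n) (A : set 'cV[R]_n) :
  (Q^T *m Q = 1%:M)%R -> measurable A -> gauss [set z | A (Q *m z)%R] = gauss A.
Proof.
move=> QQ mA; have Qu : Q \in unitmx by case: (mulmx1_unit QQ).
rewrite /gauss integral_mkcond [RHS]integral_mkcond.
have := @ge0_integral_lebesgue_cV_mulmx n Q ((fun z => (phi z)%:E) \_ A) Qu.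
under [X in _ -> _ -> _ = X * _]eq_integral do rewrite std_pdf_orthogonal//.
rewrite integral_std_pdf mul1e => <-.
- by apply: eq_integral => z _; rewrite !patchE std_pdf_orthogonal.
- apply: measurable_patch => //.
  by apply/measurable_EFinP; exact: measurable_std_pdf.
- by move=> z; apply: erestrict_ge0 => y _; rewrite lee_fin std_pdf_ge0.
Qed.

(** W is a corner of the symmetric orthogonal matrix Q below, so W Z is a block of
    a rotated standard Gaussian vector. *)
Lemma gauss_coisometry n k (W : 'M[R]_(n, k)) (A : set 'cV[R]_n) :
  (W *m W^T = 1%:M)%R -> measurable A -> gauss [set z | A (W *m z)%R] = gauss A.
Proof.
move=> WW mA.
pose Q : 'M[R]_(k + n) := block_mx (1%:M - W^T *m W) W^T W 0.
have PP : ((W^T *m W) *m (W^T *m W) = W^T *m W)%R.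
  by rewrite mulmxA -(mulmxA W^T) WW mulmx1.
have PW : ((W^T *m W) *m W^T = W^T)%R by rewrite -mulmxA WW mulmx1.
have WP : (W *m (W^T *m W) = W)%R by rewrite mulmxA WW mul1mx.
have QQ : (Q^T *m Q = 1%:M)%R.
  rewrite tr_block_mx trmxK trmx0 linearB /= trmx1 trmx_mul trmxK mulmx_block.
  rewrite WW !mulmx0 !mul0mx !addr0 [RHS](scalar_mx_block _ _ 1); congr block_mx.
  - by rewrite mulmxBl mul1mx mulmxBr mulmx1 PP subrr subr0 subrK.
  - by rewrite mulmxBl mul1mx PW subrr.
  - by rewrite mulmxBr mulmx1 WP subrr.
rewrite -[RHS]mul1e -(@probability_setT _ _ R (@gauss R k)).
rewrite -[LHS]mule1 -(@probability_setT _ _ R (@gauss R n)).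
have mWA : measurable [set z | A (W *m z)%R].
  exact: (measurable_preimage (measurable_mulmxl W (@measurable_id _ _ setT))).
rewrite -!gauss_prod// -[RHS](gauss_orthogonal QQ); last exact: measurable_usub_dsub.
have QE z : (dsubmx (Q *m z) = W *m usubmx z)%R.
  by rewrite -{1}(vsubmxK z) mul_block_col mul0mx addr0 col_mxKd.
by congr gauss; apply/seteqP; split => z /=; rewrite QE => -[].
Qed.

(** Let Pi be the orthogonal projection onto the row space of M2, so that M1 Pi = 0
    and M2 Pi = M2.  For independent standard vectors Z and Z', the vector
    (1 - Pi) Z + Pi Z' is standard too; its images under M1 and M2 are M1 Z and
    M2 Z', which are independent. *)
Lemma gauss_indep n p k (M1 : 'M[R]_(n, k)) (M2 : 'M[R]_(p, k))
    (A : set 'cV[R]_n) (B : set 'cV[R]_p) :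
  (M1 *m M2^T = 0)%R -> (M2 *m M2^T)%R \in unitmx -> measurable A -> measurable B ->
  gauss [set z | A (M1 *m z)%R /\ B (M2 *m z)%R] =
  gauss [set z | A (M1 *m z)%R] * gauss [set z | B (M2 *m z)%R].
Proof.
move=> M12 Nu mA mB; set N := (M2 *m M2^T)%R in Nu.
pose Pi := (M2^T *m invmx N *m M2)%R.
have NT : (N^T = N)%R by rewrite trmx_mul trmxK.
have PiT : (Pi^T = Pi)%R by rewrite !trmx_mul trmxK trmx_inv NT mulmxA.
have M2Pi : (M2 *m Pi = M2)%R by rewrite !mulmxA mulmxV// mul1mx.
have M1Pi : (M1 *m Pi = 0)%R by rewrite !mulmxA M12 !mul0mx.
have PiPi : (Pi *m Pi = Pi)%R.
  by rewrite {1}/Pi -mulmxA M2Pi.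
clearbody Pi.
pose W : 'M[R]_(k, k + k) := row_mx (1%:M - Pi) Pi.
have WW : (W *m W^T = 1%:M)%R.
  rewrite tr_row_mx mul_row_col linearB /= trmx1 PiT.
  by rewrite mulmxBl mul1mx mulmxBr mulmx1 PiPi subrr subr0 subrK.
have mS k' n' (M : 'M[R]_(n', k')) (D : set 'cV[R]_n') :
    measurable D -> measurable [set z | D (M *m z)%R].
  exact: (measurable_preimage (measurable_mulmxl M (@measurable_id _ _ setT))).
rewrite -[LHS](gauss_coisometry WW); last by apply: measurableI; exact: mS.
rewrite -gauss_prod; [|exact: mS..].
have WE z : (W *m z = usubmx z - Pi *m usubmx z + Pi *m dsubmx z)%R.
  by rewrite -{1}(vsubmxK z) mul_row_col mulmxBl mul1mx.
have M1W z : (M1 *m (W *m z) = M1 *m usubmx z)%R.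
  by rewrite WE mulmxDr mulmxBr !mulmxA M1Pi !mul0mx subr0 addr0.
have M2W z : (M2 *m (W *m z) = M2 *m dsubmx z)%R.
  by rewrite WE mulmxDr mulmxBr !(mulmxA M2) M2Pi subrr add0r.
by congr gauss; apply/seteqP; split => z /=; rewrite M1W M2W.
Qed.

End rotation.

(** * Change of variables for a Cholesky factor *)

Section nondegenerate.
Context {R : realType}.
Local Notation leb := (@lebesgue_measure R).
Local Notation phi := (gaussian_pdf 0 1%:M).
Local Notation npdf := (normal_pdf (0 : R) 1).
Implicit Types n k l p : nat.

Lemma consVE n (a : R) (z : 'cV[R]_n) :
  consV (a, z) = col_mx (a%:M : 'M[R]_1) z :> 'cV[R]_(1 + n).
Proof.
apply/colP => i; rewrite !mxE.
case: splitP => j.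
  rewrite ord1 => i0; rewrite (_ : i = ord0); last exact/val_inj.
  by rewrite unlift_none mxE eqxx mulr1n.
move=> ij; rewrite (_ : i = lift ord0 j) ?liftK//.
by apply/val_inj; rewrite /= ij.
Qed.

Lemma integral_npdf_scale (s : R) : 0 < s ->
  (\int[leb]_a (npdf (s * a))%:E = (s^-1)%:E)%E.
Proof.
move=> s0; have s'0 : s^-1 != 0 by rewrite invr_eq0 gt_eqF.
transitivity (\int[leb]_a ((s^-1)%:E * (normal_pdf 0 s^-1 a)%:E))%E; last first.
  rewrite ge0_integralZl//; last 3 first.
  - by apply/measurable_EFinP; exact: measurable_normal_pdf.
  - by move=> a _; rewrite lee_fin normal_pdf_ge0.
  - by rewrite lee_fin invr_ge0 ltW.
  by rewrite integral_normal_pdf mule1.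
apply: eq_integral => a _; rewrite -EFinM; congr EFin.
rewrite !normal_pdfE ?oner_eq0// /normal_peak /normal_fun !subr0 mulrA.
congr (_ * expR _); last first.
  by rewrite expr1n exprMn; field; rewrite gt_eqF.
rewrite expr1n mul1r -mulrnAr sqrtrM ?sqr_ge0// sqrtr_sqr gtr0_norm ?invr_gt0//.
by rewrite invfM mulrA invrK mulVf ?gt_eqF// mul1r.
Qed.

(** The integral is the constant of [ge0_integral_lebesgue_cV_mulmx] for L, that is,
    the change of variables formula.  It is proved along with the factorization:
    L is triangular, so after integrating over the last coordinates, where the
    first one only causes a translation, a one-dimensional integral remains. *)
Lemma cholesky n (Sigma : 'M[R]_n) : posdef Sigma ->
  exists L : 'M[R]_n, [/\ L *m L^T = Sigma, L \in unitmx &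
    (\int[lebesgue_cV n]_x (phi (L *m x))%:E = (`|\det L|^-1)%:E)%E].
Proof.
have mphi d (T : measurableType d) k (g : T -> 'cV[R]_k) : measurable_fun setT g ->
    measurable_fun setT (fun x => (phi (g x))%:E).
  by move=> mg; apply/measurable_EFinP/measurableT_comp => //; exact: measurable_std_pdf.
have p0 k (z : 'cV[R]_k) : (0 <= (phi z)%:E)%E by rewrite lee_fin std_pdf_ge0.
elim: n Sigma => [|n ih] Sigma [ST Spos].
  exists 1%:M; split; first by apply/matrixP => -[].
    exact: unitmx1.
  under eq_integral do rewrite mul1mx.
  by rewrite integral_std_pdf det1 normr1 invr1.
pose a := Sigma 0 0; pose b : 'cV[R]_n := dlsubmx (Sigma : 'M[R]_(1 + n)).
pose D : 'M[R]_n := drsubmx (Sigma : 'M[R]_(1 + n)).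
have SE : Sigma = block_mx a%:M b^T b D :> 'M[R]_(1 + n).
  rewrite -[LHS](@submxK _ 1 n 1 n); congr block_mx.
    by apply/matrixP => i j; rewrite !ord1 !mxE eqxx mulr1n; congr (Sigma _ _); exact/val_inj.
  by rewrite /b -[in RHS]ST trmx_dlsub trmxK.
have a0 : 0 < a.
  have := Spos (delta_mx 0 0); rewrite trmx_delta -rowE -colE !mxE; apply.
  by apply/eqP => /matrixP/(_ 0 0)/eqP; rewrite !mxE !eqxx oner_eq0.
pose s := Num.sqrt a.
have s0 : 0 < s by rewrite sqrtr_gt0.
have ss : s * s = a by rewrite -expr2 sqr_sqrtr// ltW.
pose S' := D - a^-1 *: (b *m b^T).
have S'pos : posdef S'.
  split=> [|z z0].
    rewrite /S' linearB linearZ /= trmx_mul trmxK; congr (_ - _).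
    by rewrite /D trmx_drsub [in LHS]ST.
  (* Minimizing Sigma over vectors with last block z leaves the Schur complement. *)
  pose w : 'M[R]_1 := - (a^-1 *: (b^T *m z)).
  pose v : 'cV[R]_(1 + n) := col_mx w z.
  have v0 : v != 0.
    by apply: contra_neq z0 => v0; rewrite -(col_mxKd w z) -/v v0 linear0.
  have -> : z^T *m S' *m z = v^T *m (Sigma : 'M[R]_(1 + n)) *m v.
    have wT : w^T = - (a^-1 *: (z^T *m b)).
      by rewrite /w linearN linearZ /= trmx_mul trmxK.
    rewrite [in RHS]SE /v tr_col_mx mul_row_block mul_row_col wT.
    rewrite [_ *m a%:M](_ : _ = - (z^T *m b)); last first.
      by rewrite mul_mx_scalar scalerN scalerA mulfV ?gt_eqF// scale1r.
    rewrite addNr mul0mx add0r mulNmx -scalemxAl addrC /S' mulmxBr.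
    by rewrite -scalemxAr mulmxA.
  exact: Spos.
have [L' [LL' L'u L'int]] := ih _ S'pos.
pose L : 'M[R]_(1 + n) := block_mx s%:M 0 (s^-1 *: b) L'.
have detL : \det L = s * \det L' by rewrite det_lblock det_scalar1.
exists L; split.
- have LT : L^T = block_mx s%:M (s^-1 *: b)^T 0 L'^T :> 'M[R]_(1 + n).
    by rewrite tr_block_mx trmx0 tr_scalar_mx.
  transitivity (L *m (block_mx s%:M (s^-1 *: b)^T 0 L'^T : 'M[R]_(1 + n))).
    by rewrite -LT.
  rewrite SE mulmx_block !mul0mx !mulmx0 !addr0.
  rewrite linearZ /= -scalar_mxM ss mul_scalar_mx mul_mx_scalar !scalerA.
  rewrite divff ?gt_eqF// !scale1r -scalemxAl -scalemxAr scalerA -invfM ss LL'.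
  by rewrite /S' addrC subrK.
- by rewrite unitmxE detL unitrM -unitmxE L'u unitfE gt_eqF.
rewrite ge0_integral_lebesgue_cVS//; last first.
  by apply: mphi; exact: measurable_mulmxl.
have LE x (z : 'cV[R]_n) : L *m consV (x, z) = consV (s * x, (x / s) *: b + L' *m z).
  rewrite !consVE mul_block_col mul0mx addr0 -scalar_mxM; congr (col_mx _ (_ + _)).
  by rewrite mul_mx_scalar scalerA.
under eq_integral => x _.
  under eq_integral => z _.
    rewrite LE std_pdf_consV EFinM.
    rewrite (_ : _ + _ = L' *m (z + invmx L' *m ((x / s) *: b))); last first.
      by rewrite mulmxDr mulKVmx// addrC.
    over.
  rewrite ge0_integralZl//=; last 2 first.
  - by apply: mphi; apply: measurable_mulmxl; exact: measurable_mxD.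
  - by rewrite lee_fin normal_pdf_ge0.
  rewrite (ge0_integral_lebesgue_cVD _ (f := fun z => (phi (L' *m z))%:E))//; last first.
    by apply: mphi; exact: measurable_mulmxl.
  rewrite L'int muleC.
  over.
rewrite /= ge0_integralZl//; last 2 first.
- apply/measurable_EFinP; apply: (measurableT_comp (measurable_normal_pdf _ _)).
  exact: measurable_funM.
- by move=> x _; rewrite lee_fin normal_pdf_ge0.
by rewrite integral_npdf_scale// -EFinM detL normrM (gtr0_norm s0) invfM mulrC.
Qed.

End nondegenerate.

(** * Gaussian densities and the second moment in dimension one *)

Section gauss_density_moments.
Context {R : realType}.
Local Notation leb := (@lebesgue_measure R).
Local Notation phi := (gaussian_pdf 0 1%:M).
Local Notation npdf := (normal_pdf (0 : R) 1).
Implicit Types n k l p : nat.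

(** With a Cholesky factor L of Sigma, L^-1 M is a coisometry, so M Z and L Z have
    the same law; the density of m + L Z is found by the change of variables L. *)
Lemma integral_gaussian_pdf n k (m : 'cV[R]_n) (Sigma : 'M[R]_n)
    (M : 'M[R]_(n, k)) (A : set 'cV[R]_n) :
  posdef Sigma -> M *m M^T = Sigma -> measurable A ->
  (\int[lebesgue_cV n]_(z in A) (gaussian_pdf m Sigma z)%:E =
   gauss [set z | A (m + M *m z)%R])%E.
Proof.
move=> Spos MM mA; have [L [LL Lu Lint]] := cholesky Spos.
have detL0 : \det L != 0 by rewrite -unitfE -unitmxE.
have LTu : L^T \in unitmx by rewrite unitmx_tr.
pose W := invmx L *m M.
have WW : W *m W^T = 1%:M.
  rewrite trmx_mul mulmxA -(mulmxA _ M) MM -LL mulKmx// trmx_inv.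
  by rewrite mulmxV.
pose D := [set x | A (m + L *m x)%R].
have mD : measurable D.
  apply: measurable_preimage mA; apply: measurable_mxD => //.
  exact: measurable_mulmxl.
have -> : [set z | A (m + M *m z)%R] = [set z | D (W *m z)].
  by apply/seteqP; split => z; rewrite /D /= /W !mulmxA mulmxV// mul1mx.
rewrite gauss_coisometry//.
have pdf0 z : 0 <= gaussian_pdf m Sigma z by rewrite divr_ge0 ?expR_ge0.
pose F := (EFin \o gaussian_pdf m Sigma) \_ A.
have F0 z : (0 <= F z)%E by apply: erestrict_ge0 => y _; rewrite lee_fin.
have mF : measurable_fun setT F.
  apply: measurable_patch => //; apply/measurable_EFinP.
  exact: measurable_gaussian_pdf.
have mFm : measurable_fun setT (fun z : 'cV[R]_n => F (z + m)).
  by apply: (measurableT_comp mF); exact: measurable_mxD.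
rewrite [LHS]integral_mkcond -[LHS](@ge0_integral_lebesgue_cVD _ _ F m)//.
have FL x : F (L *m x + m) = (`|\det L|^-1%:E * ((EFin \o phi) \_ D) x)%E.
  rewrite /F !patchE (_ : (_ \in D) = (L *m x + m \in A)); last first.
    by rewrite /D; apply/idP/idP; rewrite !inE /= addrC.
  case: ifP => _; last by rewrite mule0.
  rewrite /= -EFinM; congr EFin.
  rewrite std_pdfE /gaussian_pdf addrK -LL det_mulmx det_tr -expr2.
  rewrite sqrtrM ?exprn_ge0 ?mulr_ge0 ?pi_ge0// sqrtr_sqr.
  rewrite (_ : (L *m x)^T *m invmx (L *m L^T) *m (L *m x) = x^T *m x).
    by rewrite invfM mulrA mulrC.
  have Lx : invmx (L *m L^T) *m (L *m x) = invmx L^T *m x.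
    rewrite -[RHS](mulKmx (_ : L *m L^T \in unitmx)) ?unitmx_mul ?Lu//.
    by rewrite -!mulmxA mulKVmx.
  by rewrite -mulmxA Lx trmx_mul -mulmxA mulKVmx.
have := ge0_integral_lebesgue_cV_mulmx Lu mFm (fun z => F0 _).
under eq_integral do rewrite FL.
rewrite Lint ge0_integralZl//; last 2 first.
- apply: measurable_patch => //.
  by apply/measurable_EFinP; exact: measurable_std_pdf.
- by move=> z _; apply: erestrict_ge0 => y _; rewrite lee_fin std_pdf_ge0.
move=> /(congr1 (fun x => `|\det L|%:E * x)%E).
rewrite !muleA -EFinM mulfV ?normr_eq0// !mul1e => <-.
by rewrite -integral_mkcond.
Qed.

Lemma ge0_integral_gauss_coisometry n k (W : 'M[R]_(n, k)) (f : 'cV[R]_n -> \bar R) :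
  W *m W^T = 1%:M -> measurable_fun setT f -> (forall z, 0 <= f z)%E ->
  (\int[@gauss R k]_z f (W *m z)%R = \int[@gauss R n]_z f z)%E.
Proof.
move=> WW mf f0.
have mW : measurable_fun setT (fun z : 'cV[R]_k => W *m z).
  exact: measurable_mulmxl.
have := @ge0_integral_pushforward _ _ _ _ R _ mW (@gauss R k) setT f.
rewrite preimage_setT => <- //.
apply: eq_measure_integral => A mA _.
exact: gauss_coisometry.
Qed.

Lemma npdfE (a : R) : npdf a = normal_peak 1 * expR (- a ^+ 2 / 2).
Proof.
rewrite normal_pdfE ?oner_eq0//; transitivity (normal_peak 1 * normal_fun 0 1 a) => //.
by rewrite /normal_fun subr0 expr1n.
Qed.

(** Scaling the density by s gives the mass 1 / s.  As expR lies above its tangents,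
    this bounds the second moment by 2 / (s * (1 + s)), from above when s < 1 and
    from below when s > 1; both bounds tend to 1 with s. *)
Lemma npdf_second_moment : (\int[leb]_a ((a ^+ 2 * npdf a)%:E) = 1)%E.
Proof.
set m2 := (\int[leb]_a _)%E.
have mnp (s : R) : measurable_fun setT (fun a : measurableTypeR R => (npdf (s * a))%:E).
  apply/measurable_EFinP; apply: (measurableT_comp (measurable_normal_pdf _ _)).
  exact: measurable_funM.
have mnp1 : measurable_fun setT (fun a : measurableTypeR R => (npdf a)%:E).
  by apply/measurable_EFinP; exact: measurable_normal_pdf.
have mm2 : measurable_fun setT (fun a : measurableTypeR R => (a ^+ 2 * npdf a)%:E).
  apply/measurable_EFinP; apply: measurable_funM; first exact: measurable_funX.
  exact: measurable_normal_pdf.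
have np0 a : 0 <= npdf a by exact: normal_pdf_ge0.
have m20 a : (0 <= (a ^+ 2 * npdf a)%:E)%E by rewrite lee_fin mulr_ge0 ?sqr_ge0.
have convex (s a : R) : npdf a * (1 + (1 - s ^+ 2) / 2 * a ^+ 2) <= npdf (s * a).
  rewrite !npdfE -[X in X <= _]mulrA ler_wpM2l ?normal_peak_ge0//.
  have -> : - (s * a) ^+ 2 / 2 =
    - a ^+ 2 / 2 + (1 - s ^+ 2) / 2 * a ^+ 2 by field.
  by rewrite expRD ler_wpM2l ?expR_ge0// expR_ge1Dx.
have up (s : R) : 0 < s < 1 -> (1 + ((1 - s ^+ 2) / 2)%:E * m2 <= (s^-1)%:E)%E.
  move=> /andP[s0 s1].
  have c0 : 0 <= (1 - s ^+ 2) / 2 by rewrite divr_ge0// subr_ge0 expr_le1// ltW.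
  rewrite -(integral_npdf_scale s0) -[X in (X + _)%E](@integral_normal_pdf R 0 1).
  rewrite -ge0_integralZl// -ge0_integralD//; last 3 first.
  - by move=> a _; rewrite lee_fin.
  - by move=> a _; rewrite mule_ge0.
  - exact: measurable_funeM.
  apply: ge0_le_integral => //.
  - move=> a _; rewrite -EFinM -EFinD lee_fin.
    by rewrite addr_ge0// mulr_ge0// mulr_ge0// sqr_ge0.
  - by apply: emeasurable_funD => //; exact: measurable_funeM.
  - move=> a _; rewrite -EFinM -EFinD lee_fin.
    by rewrite [leLHS](_ : _ = npdf a * (1 + (1 - s ^+ 2) / 2 * a ^+ 2))//; ring.
have lo (s : R) : 1 < s -> (1 <= (s^-1)%:E + ((s ^+ 2 - 1) / 2)%:E * m2)%E.
  move=> s1; have s0 : 0 < s by rewrite (lt_trans _ s1).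
  have c0 : 0 <= (s ^+ 2 - 1) / 2 by rewrite divr_ge0// subr_ge0 expr_ge1// ltW.
  rewrite -(integral_npdf_scale s0) -[X in (X <= _)%E](@integral_normal_pdf R 0 1).
  rewrite -ge0_integralZl// -ge0_integralD//; last 3 first.
  - by move=> a _; rewrite lee_fin.
  - by move=> a _; rewrite mule_ge0.
  - exact: measurable_funeM.
  apply: ge0_le_integral => //.
  - by move=> a _; rewrite lee_fin.
  - by apply: emeasurable_funD => //; exact: measurable_funeM.
  - move=> a _; rewrite -EFinM -EFinD lee_fin.
    rewrite -lerBlDr.
    by rewrite [leLHS](_ : _ = npdf a * (1 + (1 - s ^+ 2) / 2 * a ^+ 2))//; ring.
have m2ge0 : (0 <= m2)%E by exact: integral_ge0.
have m2fin : m2 \is a fin_num.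
  rewrite ge0_fin_numE//.
  (* An infinite moment would contradict the upper bound for any s < 1. *)
  have s12 : 0 < (2^-1 : R) < 1 by rewrite invr_gt0 ltr0n invf_lt1// ltr1n.
  have c0 : 0 < (1 - 2^-1 ^+ 2) / 2 :> R by rewrite divr_gt0// subr_gt0 expr_lt1//; lra.
  have := up _ s12; rewrite -[m2 in X in X -> _]/m2.
  case: (m2) m2ge0 => [r _ _||//]; first exact: ltry.
  by rewrite gt0_muley ?lte_fin// addey.
move: up lo m2ge0 m2fin; case: m2 => [r| |]// up lo; rewrite lee_fin => r0 _.
congr EFin; apply/eqP; rewrite eq_le; apply/andP; split.
- rewrite leNgt; apply/negP => r1.
  have r3 : 0 < 3 * r by rewrite mulr_gt0// (lt_trans _ r1).
  (* At s = 1 - e the upper bound reads r * (2 - 3 * e + e ^+ 2) <= 2. *)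
  pose e := (r - 1) / (3 * r); have e0 : 0 < e by rewrite divr_gt0// subr_gt0.
  have re : r * e = (r - 1) / 3 by rewrite /e; field; rewrite gt_eqF// (lt_trans _ r1).
  have e1 : e < 1 by rewrite ltr_pdivrMr// mul1r; lra.
  have := up (1 - e); rewrite subr_gt0 e1 ltrBlDr ltrDl e0 => /(_ isT).
  rewrite -EFinM -EFinD lee_fin.
  have s0 : 0 < 1 - e by rewrite subr_gt0.
  rewrite -(ler_pM2l s0) mulfV ?gt_eqF// => H.
  have : e * ((1 - e) * (2 - e) * r) <= e * 2 by lra.
  rewrite ler_pM2l// => H2.
  have H3 : (1 - e) * (2 - e) * r = 2 * r - 3 * (r * e) + e * (r * e) by ring.
  have e're : 0 < e * (r * e) by rewrite mulr_gt0// mulr_gt0// (lt_trans _ r1).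
  by move: H2; rewrite H3 re; move: e're; rewrite re; lra.
- rewrite leNgt; apply/negP => r1.
  (* At s = 1 + e the lower bound reads 2 <= r * (2 + 3 * e + e ^+ 2). *)
  pose e := (1 - r) / 4; have e0 : 0 < e by rewrite divr_gt0// subr_gt0.
  have e1 : e <= 4^-1 by rewrite /e; lra.
  have := lo (1 + e); rewrite ltrDl e0 => /(_ isT).
  rewrite -EFinM -EFinD lee_fin.
  have s0 : 0 < 1 + e by rewrite addr_gt0.
  rewrite -(ler_pM2l s0) mulr1 mulrDr mulfV ?gt_eqF// => H.
  have : e * 2 <= e * ((1 + e) * (2 + e) * r) by lra.
  rewrite ler_pM2l// => H2.
  have H3 : (1 + e) * (2 + e) * r <= (2 + 4 * e) * r.
    by rewrite ler_wpM2r//; have := ler_wpM2l (ltW e0) e1; lra.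
  have := le_trans H2 H3; rewrite /e; have : 0 < (1 - r) * (2 - r).
    by rewrite mulr_gt0//; lra.
  lra.
Qed.

End gauss_density_moments.

(** * Moments of linear functionals of a Gaussian vector *)

Section gauss_moments.
Context {R : realType}.
Local Notation leb := (@lebesgue_measure R).
Local Notation phi := (gaussian_pdf 0 1%:M).
Local Notation npdf := (normal_pdf (0 : R) 1).
Implicit Types n k l p : nat.

Let lin k (c : 'rV[R]_k) (z : 'cV[R]_k) : R := (c *m z) 0 0.

Let measurable_lin k (c : 'rV[R]_k) : measurable_fun setT (lin c).
Proof.
have /measurable_fun_matrixP := @measurable_mulmxl R _ _ _ _ _ c _
  (@measurable_id _ 'cV[R]_k setT).
exact.
Qed.

Let second_moment1 : (\int[@gauss R 1]_z ((z 0 0) ^+ 2)%:E = 1)%E.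
Proof.
have mz : measurable_fun setT (fun z : 'cV[R]_1 => ((z 0 0) ^+ 2)%:E).
  by apply/measurable_EFinP/measurable_funX; exact: measurable_matrix_coord.
have mp k : measurable_fun setT (fun z : 'cV[R]_k => (phi z)%:E).
  by apply/measurable_EFinP; exact: measurable_std_pdf.
rewrite ge0_integral_gauss//; last by move=> z; rewrite lee_fin sqr_ge0.
rewrite ge0_integral_lebesgue_cVS//; last 2 first.
- exact: (emeasurable_funM mz (mp _)).
- by move=> z; rewrite mule_ge0// lee_fin ?sqr_ge0 ?std_pdf_ge0.
rewrite -npdf_second_moment; apply: eq_integral => a _.
rewrite ge0_integral_lebesgue_cV0.
- rewrite -EFinM std_pdf_consV mxE [unlift _ _]unlift_none /=.
  by rewrite [phi _]std_pdfE mxE big_ord0 oppr0 mul0r expR0 expr0 sqrtr1 divr1 mulr1.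
- have mc := @measurable_consVr R 0 a.
  by apply: emeasurable_funM; [exact: (measurableT_comp mz)|exact: (measurableT_comp (mp _))].
- by move=> z; rewrite mule_ge0// lee_fin ?sqr_ge0 ?std_pdf_ge0.
Qed.

(** After division by the norm of c, the functional is a coisometry onto dimension
    one. *)
Lemma gauss_second_moment k (c : 'rV[R]_k) :
  (\int[@gauss R k]_z ((c *m z) 0 0 ^+ 2)%:E = ((c *m c^T) 0 0)%:E)%E.
Proof.
set q := (c *m c^T) 0 0.
have qE : q = \sum_j c 0 j ^+ 2.
  by rewrite /q mxE; apply: eq_bigr => j _; rewrite mxE expr2.
have q0 : 0 <= q by rewrite qE sumr_ge0// => j _; exact: sqr_ge0.
have [qz|qn0] := eqVneq q 0.
  have c0 : c = 0.
    apply/rowP => j; rewrite mxE; apply/eqP; rewrite -sqrf_eq0; apply/eqP.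
    have /eqP := esym qE; rewrite qz psumr_eq0 => [|i _]; last exact: sqr_ge0.
    by move=> /allP/(_ j (mem_index_enum _))/eqP.
  by rewrite qz; apply: integral0_eq => z _; rewrite c0 mul0mx mxE expr0n.
have qp : 0 < q by rewrite lt_def qn0.
pose W := (Num.sqrt q)^-1 *: c.
have WW : W *m W^T = 1%:M.
  apply/matrixP => i j; rewrite !ord1 linearZ /= -scalemxAl -scalemxAr scalerA mxE.
  by rewrite -invfM -expr2 sqr_sqrtr// -/q mulVf// mxE.
have mz : measurable_fun setT (fun z : 'cV[R]_1 => ((z 0 0) ^+ 2)%:E).
  by apply/measurable_EFinP/measurable_funX; exact: measurable_matrix_coord.
have mWz : measurable_fun setT (fun z : 'cV[R]_k => (((W *m z) 0 0) ^+ 2)%:E).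
  by apply/measurable_EFinP/measurable_funX; exact: measurable_lin.
have E z : ((c *m z) 0 0 ^+ 2)%:E = (q%:E * ((W *m z) 0 0 ^+ 2)%:E)%E.
  by rewrite -scalemxAl [in RHS]mxE -EFinM exprMn exprVn sqr_sqrtr// mulrA divff ?mul1r.
under eq_integral do rewrite E.
rewrite ge0_integralZl//; last by move=> z _; rewrite lee_fin sqr_ge0.
rewrite (ge0_integral_gauss_coisometry WW (f := fun z => ((z 0 0) ^+ 2)%:E))//.
  by rewrite second_moment1 mule1.
by move=> z; rewrite lee_fin sqr_ge0.
Qed.

Let integrable_sq k (c : 'rV[R]_k) :
  (@gauss R k).-integrable setT (fun z => ((lin c z) ^+ 2)%:E).
Proof.
apply/integrableP; split.
  by apply/measurable_EFinP/measurable_funX; exact: measurable_lin.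
under eq_integral do rewrite gee0_abs ?lee_fin ?sqr_ge0//.
by rewrite gauss_second_moment ltry.
Qed.

Lemma gauss_integrable_lin k (c : 'rV[R]_k) :
  (@gauss R k).-integrable setT (fun z => ((c *m z) 0 0)%:E).
Proof.
have i1 : (@gauss R k).-integrable setT (fun z => (1 + (lin c z) ^+ 2)%:E).
  under eq_fun do rewrite EFinD.
  apply: integrableD => //; exact: finite_measure_integrable_cst.
apply: le_integrable i1 => //.
  by apply/measurable_EFinP; exact: measurable_lin.
move=> z _ /=; rewrite lee_fin -/(lin c z) [leRHS]ger0_norm; last first.
  by rewrite addr_ge0// sqr_ge0.
rewrite ler_norml; apply/andP; split.
  have := sqr_ge0 (lin c z + 2^-1); rewrite sqrrD; have := sqr_ge0 (lin c z); lra.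
have := sqr_ge0 (lin c z - 2^-1); rewrite sqrrB; have := sqr_ge0 (lin c z); lra.
Qed.

(** The measure is invariant under z |-> - z. *)
Lemma gauss_mean k (c : 'rV[R]_k) :
  (\int[@gauss R k]_z ((c *m z) 0 0)%:E = 0)%E.
Proof.
have NN : (- 1%:M : 'M[R]_k) *m (- 1%:M : 'M[R]_k)^T = 1%:M.
  by rewrite linearN /= trmx1 mulNmx mulmxN mul1mx opprK.
pose f (z : 'cV[R]_k) : \bar R := ((c *m z) 0 0)%:E.
have mf : measurable_fun setT f by apply/measurable_EFinP; exact: measurable_lin.
have fneg : (\int[@gauss R k]_z f^\- z = \int[@gauss R k]_z f^\+ z)%E.
  rewrite -[RHS](ge0_integral_gauss_coisometry NN)//; last exact: measurable_funepos.
  apply: eq_integral => z _; rewrite funenegE funeposE; congr maxe.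
  by rewrite /f mulNmx mul1mx mulmxN [in RHS]mxE.
rewrite -[LHS]/(\int[@gauss R k]_z f z)%E integralE fneg subee//.
exact: integrable_pos_fin_num (gauss_integrable_lin c).
Qed.

Lemma gauss_integrable_mul k (c c' : 'rV[R]_k) :
  (@gauss R k).-integrable setT (fun z => ((c *m z) 0 0 * (c' *m z) 0 0)%:E).
Proof.
have i1 : (@gauss R k).-integrable setT (fun z => (lin c z ^+ 2 + lin c' z ^+ 2)%:E).
  under eq_fun do rewrite EFinD.
  by apply: integrableD.
apply: le_integrable i1 => //.
  by apply/measurable_EFinP; apply: measurable_funM; exact: measurable_lin.
move=> z _ /=; rewrite lee_fin -/(lin c z) -/(lin c' z) [leRHS]ger0_norm; last first.
  by rewrite addr_ge0// sqr_ge0.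
rewrite ler_norml; apply/andP; split.
  have := sqr_ge0 (lin c z + lin c' z); rewrite sqrrD.
  have := sqr_ge0 (lin c z); have := sqr_ge0 (lin c' z); lra.
have := sqr_ge0 (lin c z - lin c' z); rewrite sqrrB.
have := sqr_ge0 (lin c z); have := sqr_ge0 (lin c' z); lra.
Qed.

(** Polarization of [gauss_second_moment]. *)
Lemma gauss_covariance k (c c' : 'rV[R]_k) :
  (\int[@gauss R k]_z ((c *m z) 0 0 * (c' *m z) 0 0)%:E = ((c *m c'^T) 0 0)%:E)%E.
Proof.
have E z : ((c *m z) 0 0 * (c' *m z) 0 0)%:E =
    (4^-1%:E * (((lin (c + c') z) ^+ 2)%:E - ((lin (c - c') z) ^+ 2)%:E))%E.
  by rewrite -EFinB -EFinM /lin mulmxDl mulmxBl !mxE; congr EFin; field.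
under eq_integral do rewrite E.
rewrite integralZl//; last exact: integrableB.
rewrite integralB// !gauss_second_moment -EFinB -EFinM; congr EFin.
have DT : (c + c')^T = c^T + c'^T by rewrite linearD.
have BT : (c - c')^T = c^T - c'^T by rewrite linearB.
have cc : (c' *m c^T) 0 0 = (c *m c'^T) 0 0.
  by rewrite -[in LHS](trmxK c') -trmx_mul mxE.
have ENT (x y : 'M[R]_1) : (x + y) 0 0 = x 0 0 + y 0 0 by rewrite mxE.
have NNT (x : 'M[R]_1) : (- x) 0 0 = - x 0 0 by rewrite mxE.
rewrite DT BT !mulmxDl !mulmxDr !mulNmx !mulmxN !(ENT, NNT) cc.
by field.
Qed.

End gauss_moments.

(** * Independence *)

Lemma mul_row_split (R : pzRingType) m k l (A : 'M[R]_(m, k)) (B : 'M[R]_(m, l))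
    (z : 'cV[R]_(k + l)) :
  row_mx A B *m z = A *m usubmx z + B *m dsubmx z.
Proof. by rewrite -{1}[z]vsubmxK mul_row_col. Qed.

Section independence.
Context {R : realType} d (T : measurableType d) (P : probability T R).
Local Open Scope ereal_scope.

(** The events D satisfying the product rule form a Dynkin system.  The probability
    Q describes the law expected of f; with S = T and f' = f this is the
    independence of f and E. *)
Lemma pi_lambda_indep d' (S : measurableType d') (Q : probability S R)
    U (G : set (set U)) (f : T -> U) (f' : S -> U) (E : set T) :
  setI_closed G -> measurable E ->
  (forall D, G D -> measurable (f @^-1` D)) ->
  (forall D, G D -> measurable (f' @^-1` D)) ->
  (forall D, G D -> P (E `&` f @^-1` D) = P E * Q (f' @^-1` D)) ->
  forall D, <<s G >> D -> P (E `&` f @^-1` D) = P E * Q (f' @^-1` D).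
Proof.
move=> GI mE mf mf' GE.
pose H := [set D | [/\ measurable (f @^-1` D), measurable (f' @^-1` D) &
  P (E `&` f @^-1` D) = P E * Q (f' @^-1` D)]].
suff sH : <<s G >> `<=` H by move=> D /sH[].
apply: lambda_system_subset => //; last first.
  by move=> D GD; split; [exact: mf|exact: mf'|exact: GE].
apply/dynkin_lambda_system; split.
- by rewrite /H /= !preimage_setT setIT probability_setT mule1; split.
- move=> D [mD mD' DE]; split; rewrite -!preimage_setC; [exact: measurableC..|].
  rewrite -setDE measureD//; last first.
    by rewrite -ge0_fin_numE// fin_num_measure.
  rewrite [X in _ - X]DE probability_setC// muleBr ?mule1//.
  by rewrite fin_num_measure.
- move=> F tF HF; split.
  + by rewrite preimage_bigcup; apply: bigcup_measurable => k _; have [] := HF k.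
  + by rewrite preimage_bigcup; apply: bigcup_measurable => k _; have [] := HF k.
  rewrite !preimage_bigcup setI_bigcupr !measure_bigcup//; last 4 first.
  + by move=> k _; have [] := HF k.
  + by move=> i j _ _ [x [Fi Fj]]; apply: tF => //; exists (f' x).
  + by move=> k _; apply: measurableI => //; have [] := HF k.
  + by move=> i j _ _ [x [[_ Fi] [_ Fj]]]; apply: tF => //; exists (f x).
  have PE : (fine (P E))%:E = P E by rewrite fineK// fin_num_measure.
  rewrite -PE -nneseriesZl//; apply: eq_eseriesr => k _; rewrite PE.
  by have [] := HF k.
Qed.

Lemma pi_lambda_rectangles d1 d2 (T1 : measurableType d1) (T2 : measurableType d2)
  d' (S : measurableType d') (Q : probability S R)
    (f : T -> T1 * T2) (f' : S -> T1 * T2) (E : set T) :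
  measurable E -> measurable_fun setT f -> measurable_fun setT f' ->
  (forall D1 D2, measurable D1 -> measurable D2 ->
    P (E `&` f @^-1` (D1 `*` D2)) = P E * Q (f' @^-1` (D1 `*` D2))) ->
  forall D, measurable D -> P (E `&` f @^-1` D) = P E * Q (f' @^-1` D).
Proof.
move=> mE mf mf' H D; rewrite measurable_prod_measurableType => mD.
apply: pi_lambda_indep mD => //.
- move=> _ _ [A1 mA1 [A2 mA2 <-]] [B1 mB1 [B2 mB2 <-]].
  rewrite -setXI; exists (A1 `&` B1); first exact: measurableI.
  by exists (A2 `&` B2) => //; exact: measurableI.
- by move=> _ [A1 mA1 [A2 mA2 <-]]; apply: (measurable_preimage mf); exact: measurableX.
- by move=> _ [A1 mA1 [A2 mA2 <-]]; apply: (measurable_preimage mf'); exact: measurableX.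
- by move=> _ [A1 mA1 [A2 mA2 <-]]; exact: H.
Qed.

(** The intersections of one event from each F i, with i in s, form a pi-system
    generating the joined sigma-algebra, and on it the product rule is mutual
    independence for the indices j :: s and s. *)
Lemma mutually_independent_join (I : eqType) (F : I -> set (set T)) (j : I)
    (s : seq I) (E D : set T) :
  mutually_independent P F ->
  (forall i, F i `<=` measurable) -> (forall i, F i setT) ->
  (forall i, setI_closed (F i)) ->
  uniq s -> j \notin s -> F j E -> <<s \bigcup_(i in [set` s]) F i >> D ->
  P (E `&` D) = P E * P D.
Proof.
move=> indep Fm FT FI us js FE.
pose G := [set D | exists2 X : I -> set T, (forall i, F i (X i)) &
  D = \bigcap_(i in [set` s]) X i].
have mG D' : G D' -> measurable D'.
  move=> [X FX ->]; apply: fin_bigcap_measurable => // i _; exact: Fm.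
suff FG : \bigcup_(i in [set` s]) F i `<=` G.
  move=> /(sub_sigma_algebra2 FG).
  apply: (@pi_lambda_indep _ _ P _ G idfun idfun) => //; last 1 first.
  - move=> _ [X FX ->].
    pose X' i := if i == j then E else X i.
    have X's i : i \in s -> X' i = X i.
      by move=> si; rewrite /X'; case: eqP => // ij; move: js; rewrite -ij si.
    have FX' i : F i (X' i) by rewrite /X'; case: eqP => [->|].
    have := indep (j :: s) X'; rewrite /= js us => /(_ isT (fun i _ => FX' i)).
    rewrite big_cons {2}/X' eqxx (eq_big_seq (P \o X)) => [|i si]; last first.
      by rewrite /= X's.
    rewrite /= -(indep s X us (fun i _ => FX i)) => <-; congr (P _).
    apply/seteqP; split => x.
      move=> [Ex Xx] i /=; rewrite inE => /orP[/eqP ->|si].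
        by rewrite /X' eqxx.
      by rewrite X's//; exact: Xx.
    move=> X'x; split; first by have := X'x j; rewrite /X' eqxx; apply; exact: mem_head.
    move=> i si /=; rewrite -X's//; apply: X'x.
    by rewrite /= inE (_ : i \in s) ?orbT.
  - move=> _ _ [X FX ->] [Y FY ->]; exists (fun i => X i `&` Y i).
      by move=> i; apply: FI.
    by rewrite bigcapI.
  - exact: Fm FE.
move=> A [i si FA]; exists (fun k => if k == i then A else setT).
  by move=> k; case: eqP => [->|].
apply/seteqP; split => x.
  by move=> Ax k _ /=; case: eqP.
by move=> /(_ i si); rewrite eqxx.
Qed.

(** Independence from Y and the law of e are stated together: B = setT gives the
    law of e as the image of the standard Gaussian law under M. *)
Definition indep_gauss d' (T' : measurableType d') n k (Y : T -> T')
    (e : T -> 'cV[R]_n) (M : 'M[R]_(n, k)) :=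
  forall B A, measurable B -> measurable A ->
  P (Y @^-1` B `&` e @^-1` A) = P (Y @^-1` B) * gauss [set z | A (M *m z)%R].

Lemma indep_gauss_comp d1 d2 (T1 : measurableType d1) (T2 : measurableType d2)
    n k (Y : T -> T1) (h : T1 -> T2) (e : T -> 'cV[R]_n) (M : 'M[R]_(n, k)) :
  measurable_fun setT h -> indep_gauss Y e M -> indep_gauss (h \o Y) e M.
Proof.
move=> mh iY B A mB mA; rewrite comp_preimage iY//; exact: measurable_preimage.
Qed.

(** Rectangles are covered by the two hypotheses and [gauss_prod]; the others follow
    by the pi-lambda theorem. *)
Lemma indep_gauss_stack d' (T' : measurableType d') n k q l (Y : T -> T')
    (e : T -> 'cV[R]_n) (M : 'M[R]_(n, k)) (w : T -> 'cV[R]_q) (S : 'M[R]_(q, l)) B D :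
  measurable_fun setT Y -> measurable_fun setT e -> measurable_fun setT w ->
  indep_gauss Y e M -> indep_gauss (fun om => (Y om, e om)) w S ->
  measurable B -> measurable D ->
  P (Y @^-1` B `&` [set om | D (e om, w om)]) =
  P (Y @^-1` B) * gauss [set z : 'cV[R]_(k + l) | D (M *m usubmx z, S *m dsubmx z)%R].
Proof.
move=> mY me mw iY iw mB mD.
apply: (@pi_lambda_rectangles _ _ _ _ _ _ (@gauss R (k + l)) (fun om => (e om, w om))
  (fun z : 'cV[R]_(k + l) => (M *m usubmx z, S *m dsubmx z)%R)) => //.
- exact: measurable_preimage.
- exact: measurable_fun_pair.
- apply: measurable_fun_pair; apply: measurable_mulmxl.
    exact: measurable_usubmx.
  exact: measurable_dsubmx.
move=> D1 D2 mD1 mD2.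
have := iw (B `*` D1) D2 (measurableX mB mD1) mD2.
have -> : (fun om => (Y om, e om)) @^-1` (B `*` D1) = Y @^-1` B `&` e @^-1` D1 by [].
rewrite iY// => H.
transitivity (P (Y @^-1` B `&` e @^-1` D1 `&` w @^-1` D2)).
  by congr (P _); apply/seteqP; split => om /=; rewrite /setX/=; tauto.
rewrite H -muleA; congr *%E.
have mS n' k' (N : 'M[R]_(n', k')) (A : set 'cV[R]_n') : measurable A ->
    measurable [set z | A (N *m z)%R].
  exact: (measurable_preimage (measurable_mulmxl N (@measurable_id _ _ setT))).
by rewrite -gauss_prod//; exact: mS.
Qed.

Lemma indep_gauss_lin d' (T' : measurableType d') n k q l r (Y : T -> T')
    (e : T -> 'cV[R]_n) (M : 'M[R]_(n, k)) (w : T -> 'cV[R]_q) (S : 'M[R]_(q, l))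
    (L : 'M[R]_(r, n)) (N : 'M[R]_(r, q)) :
  measurable_fun setT Y -> measurable_fun setT e -> measurable_fun setT w ->
  indep_gauss Y e M -> indep_gauss (fun om => (Y om, e om)) w S ->
  indep_gauss Y (fun om => L *m e om + N *m w om)%R (row_mx (L *m M) (N *m S)).
Proof.
move=> mY me mw iY iw B A mB mA.
have := indep_gauss_stack mY me mw iY iw mB
  (_ : measurable [set q : 'cV[R]_n * 'cV[R]_q | A (L *m q.1 + N *m q.2)%R]).
move=> ->; last first.
  apply: measurable_preimage mA; apply: measurable_mxD; exact: measurable_mulmxl.
congr (_ * gauss _); apply/seteqP.
by split => z /=; rewrite mul_row_split -!mulmxA.
Qed.

(** Given Y, the two combinations are uncorrelated images of one Gaussian vector,
    hence independent ([gauss_indep]); so the second one may be moved to the side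
    of the observations. *)
Lemma indep_gauss_condition d' (T' : measurableType d') n k q l r s (Y : T -> T')
    (e : T -> 'cV[R]_n) (M : 'M[R]_(n, k)) (w : T -> 'cV[R]_q) (S : 'M[R]_(q, l))
    (L1 : 'M[R]_(r, n)) (N1 : 'M[R]_(r, q)) (L2 : 'M[R]_(s, n)) (N2 : 'M[R]_(s, q)) :
  let M1 := row_mx (L1 *m M) (N1 *m S) in
  let M2 := row_mx (L2 *m M) (N2 *m S) in
  (M1 *m M2^T = 0)%R -> (M2 *m M2^T)%R \in unitmx ->
  measurable_fun setT Y -> measurable_fun setT e -> measurable_fun setT w ->
  indep_gauss Y e M -> indep_gauss (fun om => (Y om, e om)) w S ->
  indep_gauss (fun om => (Y om, L2 *m e om + N2 *m w om)%R)
    (fun om => L1 *m e om + N1 *m w om)%R M1.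
Proof.
move=> M1 M2 M12 M2u mY me mw iY iw D A mD mA.
pose e1 om := (L1 *m e om + N1 *m w om)%R; pose e2 om := (L2 *m e om + N2 *m w om)%R.
have me1 : measurable_fun setT e1 by apply: measurable_mxD; exact: measurable_mulmxl.
have me2 : measurable_fun setT e2 by apply: measurable_mxD; exact: measurable_mulmxl.
have i1 := indep_gauss_lin L1 N1 mY me mw iY iw.
have i2 := indep_gauss_lin L2 N2 mY me mw iY iw.
have Pe1 : P (e1 @^-1` A) = gauss [set z | A (M1 *m z)%R].
  have := i1 setT A measurableT mA.
  by rewrite preimage_setT setTI probability_setT mul1e.
rewrite setIC -Pe1 muleC.
apply: (@pi_lambda_rectangles _ _ _ _ _ _ P (fun om => (Y om, e2 om))) mD => //.
- exact: measurable_preimage.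
- exact: measurable_fun_pair.
- exact: measurable_fun_pair.
move=> D1 D2 mD1 mD2.
have mAD : measurable [set q : 'cV[R]_n * 'cV[R]_q |
    A (L1 *m q.1 + N1 *m q.2)%R /\ D2 (L2 *m q.1 + N2 *m q.2)%R].
  by apply: measurableI; [apply: measurable_preimage mA|apply: measurable_preimage mD2];
     apply: measurable_mxD; exact: measurable_mulmxl.
have := indep_gauss_stack mY me mw iY iw mD1 mAD.
have ME (z : 'cV[R]_(k + l)) : (M1 *m z = L1 *m (M *m usubmx z) + N1 *m (S *m dsubmx z))%R /\
            (M2 *m z = L2 *m (M *m usubmx z) + N2 *m (S *m dsubmx z))%R.
  by split; rewrite [LHS]mul_row_split !mulmxA.
rewrite (_ : [set z | _] = [set z | A (M1 *m z)%R /\ D2 (M2 *m z)%R]); last first.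
  by apply/seteqP; split => z /=; have [-> ->] := ME z.
rewrite gauss_indep// -Pe1 => H.
transitivity (P (e1 @^-1` A) * (P (Y @^-1` D1 `&` e2 @^-1` D2))); last by [].
rewrite i2// muleCA -H; congr (P _).
by apply/seteqP; split => om /= => [[? [? ?]]|[? [? ?]]]; split.
Qed.

End independence.

(** * Conditional expectation given a random element *)

Section conditional_expectation.
Context {R : realType} d (T : measurableType d) (P : probability T R).
Context d' (T' : measurableType d') (Y : T -> T').
Hypothesis mY : measurable_fun setT Y.
Local Notation sY := (g_sigma_algebra_preimageType Y).

Lemma preimage_measurableP (A : set T) :
  measurable (A : set sY) -> exists2 B, measurable B & A = Y @^-1` B.
Proof. by move=> [B mB <-]; exists B => //; rewrite setTI. Qed.

Lemma measurable_fun_preimage d2 (U : measurableType d2) (h : T' -> U) :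
  measurable_fun setT h -> measurable_fun setT (h \o Y : sY -> U).
Proof.
move=> mh _ B mB; exists (h @^-1` B); first exact: measurable_preimage mB.
by [].
Qed.

Lemma measurable_fun_sub_preimage d2 (U : measurableType d2) (Z : T -> U) :
  measurable_fun setT (Z : sY -> U) -> measurable_fun setT Z.
Proof.
move=> mZ _ B mB; have [C mC ->] := preimage_measurableP (mZ measurableT B mB).
exact: measurable_preimage mC.
Qed.

(** The two versions have equal integrals over the event, but these may be infinite;
    truncating Z at level k makes the subtraction legitimate. *)
Let is_condE_ge0_lt X Z Z' : is_condE_ge0 P Y X Z -> is_condE_ge0 P Y X Z' ->
  P.-negligible [set w | Z w < Z' w].
Proof.
move=> [mZ Z0 iZ] [mZ' Z'0 iZ'].
have -> : [set w | Z w < Z' w] = \bigcup_k [set w | Z w < Z' w /\ Z w <= k%:R].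
  apply/seteqP; split => [w /= ZZ|w [k _ []]//].
  exists (Num.bound (Z w)) => //; split => //.
  exact/ltW/archi_boundP.
apply: negligible_bigcup => k; set N := [set w | _].
have [B mB NB] : exists2 B, measurable B & N = Y @^-1` B.
  apply: preimage_measurableP.
  rewrite (_ : N = (fun w : sY => (Z w < Z' w) && (Z w <= k%:R)) @^-1` [set true]); last first.
    by apply/seteqP; split => w /= => [[-> ->]|/andP].
  apply: (measurable_preimage _ (_ : measurable [set true])) => //.
  apply: measurable_and; first exact: measurable_fun_ltr.
  exact: measurable_fun_ler.
have mN : measurable N by rewrite NB; exact: measurable_preimage mB.
have tZ := measurable_fun_sub_preimage mZ.
have tZ' := measurable_fun_sub_preimage mZ'.
have mD : measurable_fun N (fun w => (Z' w - Z w)%:E).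
  by apply/measurable_EFinP; apply: measurable_funTS; exact: measurable_funB.
have D0 w : N w -> (0 <= (Z' w - Z w)%:E)%E.
  by move=> [ZZ _]; rewrite lee_fin subr_ge0 ltW.
have iZfin : (\int[P]_(w in N) (Z w)%:E)%E \is a fin_num.
  rewrite ge0_fin_numE; last by apply: integral_ge0 => w _; rewrite lee_fin.
  apply: (@le_lt_trans _ _ (\int[P]_(w in N) k%:R%:E)%E).
    apply: ge0_le_integral => //.
    - by move=> w _; rewrite lee_fin.
    - by apply/measurable_EFinP; exact: measurable_funTS.
    - by move=> w [_ Zk]; rewrite lee_fin.
  rewrite integral_cst// (@le_lt_trans _ _ (k%:R%:E * 1)%E)//.
    by rewrite lee_wpmul2l// ?lee_fin// probability_le1.
  by rewrite mule1 ltry.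
have D00 : (\int[P]_(w in N) (Z' w - Z w)%:E = 0)%E.
  have : (\int[P]_(w in N) (Z' w)%:E =
          \int[P]_(w in N) (Z w)%:E + \int[P]_(w in N) (Z' w - Z w)%:E)%E.
    rewrite -ge0_integralD//.
    - by apply: eq_integral => w _; rewrite -EFinD addrC subrK.
    - by move=> w _; rewrite lee_fin.
    - by apply/measurable_EFinP; exact: measurable_funTS.
  have -> : (\int[P]_(w in N) (Z' w)%:E = \int[P]_(w in N) (Z w)%:E)%E.
    by rewrite NB iZ// iZ'.
  move/(congr1 (fun x => x - \int[P]_(w in N) (Z w)%:E)%E).
  by rewrite subee// addeC addeK.
have : ae_eq P N (fun w => (Z' w - Z w)%:E) (cst 0%E).
  apply/ae_eq_integral_abs => //; rewrite -D00.
  by apply: eq_integral => w /set_mem Nw; rewrite gee0_abs// D0.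
move=> [S [mS S0 sS]]; exists S; split => // w Nw; apply: sS => /= /(_ Nw) [].
by move/eqP; rewrite subr_eq0 => /eqP ZZ; case: Nw; rewrite ZZ ltxx.
Qed.

Lemma is_condE_ge0_unique X Z Z' :
  is_condE_ge0 P Y X Z -> is_condE_ge0 P Y X Z' -> {ae P, forall w, Z w = Z' w}.
Proof.
move=> ZX Z'X; have N1 := is_condE_ge0_lt ZX Z'X; have N2 := is_condE_ge0_lt Z'X ZX.
apply: negligibleS (negligibleU N1 N2) => w /= /eqP.
by rewrite neq_lt => /orP[]; [left|right].
Qed.

Lemma is_condE_unique X Z Z' :
  is_condE P Y X Z -> is_condE P Y X Z' -> {ae P, forall w, Z w = Z' w}.
Proof.
move=> [Zp [Zn [Zp1 Zn1 ->]]] [Zp' [Zn' [Zp1' Zn1' ->]]].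
have := is_condE_ge0_unique Zp1 Zp1'; have := is_condE_ge0_unique Zn1 Zn1'.
by apply: filterS2 => w /= -> ->.
Qed.

Lemma condEP X : has_condE P Y X -> is_condE P Y X (condE P Y X).
Proof. exact: xgetPex. Qed.

Lemma is_condE_ge0_ae (X X' Z : T -> R) : measurable_fun setT X -> measurable_fun setT X' ->
  (forall w, 0 <= X w) -> (forall w, 0 <= X' w) ->
  {ae P, forall w, X w = X' w} -> is_condE_ge0 P Y X Z -> is_condE_ge0 P Y X' Z.
Proof.
move=> mX mX' X0 X'0 XX' [mZ Z0 iZ]; split => // B mB; rewrite iZ//.
apply: ge0_ae_eq_integral => //.
- exact: measurable_preimage mB.
- by apply/measurable_EFinP; exact: measurable_funTS.
- by apply/measurable_EFinP; exact: measurable_funTS.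
- by move=> w _; rewrite lee_fin.
- by move=> w _; rewrite lee_fin.
- by apply: filterS XX' => w /= ->.
Qed.

Lemma is_condE_ae (X X' Z : T -> R) : measurable_fun setT X -> measurable_fun setT X' ->
  {ae P, forall w, X w = X' w} -> is_condE P Y X Z -> is_condE P Y X' Z.
Proof.
move=> mX mX' XX' [Zp [Zn [Zp1 Zn1 ->]]]; exists Zp, Zn; split => //.
- apply: is_condE_ge0_ae Zp1 => //; [exact: measurable_funrpos..|].
  by apply: filterS XX' => w; rewrite /funrpos /= => ->.
- apply: is_condE_ge0_ae Zn1 => //; [exact: measurable_funrneg..|].
  by apply: filterS XX' => w; rewrite /funrneg /= => ->.
Qed.

Lemma is_condE_measurable X Z : is_condE P Y X Z -> measurable_fun setT (Z : sY -> R).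
Proof.
by move=> [Zp [Zn [[mp _ _] [mn _ _] ->]]]; exact: measurable_funB.
Qed.

Section residual.
Variables (n k : nat) (e : T -> 'cV[R]_n) (M : 'M[R]_(n, k)).
Hypothesis me : measurable_fun setT e.
Hypothesis iYe : indep_gauss P Y e M.

Let measurable_idM : measurable_fun setT
  (fun q : T' * 'cV[R]_k => (q.1, M *m q.2)).
Proof.
apply: measurable_fun_pair; first exact: measurable_fst.
by apply: measurable_mulmxl; exact: measurable_snd.
Qed.

(** The joint law of (Y, e) is a product, so Tonelli applies. *)
Lemma indep_gauss_integral (G : T' * 'cV[R]_n -> \bar R) :
  measurable_fun setT G -> (forall q, 0 <= G q)%E ->
  (\int[P]_w G (Y w, e w) = \int[P]_w \int[@gauss R k]_z G (Y w, M *m z)%R)%E.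
Proof.
move=> mG G0.
pose Ym : {mfun T >-> T'} := HB.pack Y (isMeasurableFun.Build _ _ _ _ Y mY).
pose PY : probability T' R := distribution P Ym.
have mYe : measurable_fun setT (fun w => (Y w, e w)) by exact: measurable_fun_pair.
have law D : measurable D -> P ((fun w => (Y w, e w)) @^-1` D) =
    (PY \x @gauss R k)%E ((fun q => (q.1, M *m q.2)) @^-1` D).
  move=> mD.
  have := @pi_lambda_rectangles R _ T P _ _ T' 'cV[R]_n _ _ (PY \x @gauss R k)%E
    (fun w => (Y w, e w)) (fun q => (q.1, M *m q.2)) setT measurableT mYe measurable_idM.
  rewrite !probability_setT => H; have := H _ D mD.
  rewrite setTI mul1e; apply => D1 D2 mD1 mD2; rewrite setTI mul1e.
  have mMD2 : measurable [set z | D2 (M *m z)].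
    exact: (measurable_preimage (measurable_mulmxl M (@measurable_id _ _ setT))).
  rewrite -[RHS]/((PY \x @gauss R k)%E (D1 `*` [set z | D2 (M *m z)])).
  by rewrite product_measure1E// -iYe.
transitivity (\int[PY \x @gauss R k]_q G (q.1, M *m q.2)%R)%E.
  have h1 := @ge0_integral_pushforward _ _ _ _ R _ mYe P setT G.
  have h2 := @ge0_integral_pushforward _ _ _ _ R _ measurable_idM (PY \x @gauss R k)%E setT G.
  rewrite !preimage_setT in h1 h2; rewrite -h1// -h2//.
  by apply: eq_measure_integral => D mD _; exact: law.
have mGM : measurable_fun setT (fun q : T' * 'cV[R]_k => G (q.1, M *m q.2)).
  exact: measurableT_comp mG measurable_idM.
rewrite (fubini_tonelli1 (fun q : T' * 'cV[R]_k => G (q.1, M *m q.2)))//.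
have h := @ge0_integral_pushforward _ _ _ _ R _ mY P setT
  (fun y => \int[@gauss R k]_z G (y, M *m z)%R)%E.
rewrite preimage_setT in h; rewrite -h//.
- exact: (measurable_fun_fubini_tonelli_F (fun q : T' * 'cV[R]_k => G (q.1, M *m q.2))).
- by move=> y _; exact: integral_ge0.
Qed.

Let is_condE_ge0_residual (F : T' * 'cV[R]_n -> R) (psi : T' -> R) :
  measurable_fun setT F -> (forall q, 0 <= F q) ->
  (forall y, \int[@gauss R k]_z (F (y, M *m z)%R)%:E = (psi y)%:E)%E ->
  is_condE_ge0 P Y (fun w => F (Y w, e w)) (psi \o Y).
Proof.
move=> mF F0 Fpsi.
have mFM : measurable_fun setT (fun q : T' * 'cV[R]_k => (F (q.1, M *m q.2))%:E).
  by apply/measurable_EFinP; exact: measurableT_comp mF measurable_idM.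
have mpsi : measurable_fun setT psi.
  apply/measurable_EFinP.
  have := measurable_fun_fubini_tonelli_F (m2 := @gauss R k) _ mFM.
  rewrite /fubini_F => H.
  rewrite (_ : _ \o _ = (fun y => \int[@gauss R k]_z (F (y, M *m z)%R)%:E)%E).
    by apply: H => q; rewrite lee_fin.
  by apply/funext => y; rewrite Fpsi.
split.
- exact: measurable_fun_preimage.
- by move=> w; rewrite -lee_fin /= -Fpsi; apply: integral_ge0 => z _; rewrite lee_fin.
move=> B mB; have mYB : measurable (Y @^-1` B) by exact: measurable_preimage mB.
rewrite [RHS]integral_mkcond [LHS]integral_mkcond.
pose G (q : T' * 'cV[R]_n) : \bar R := ((\1_B q.1)%:E * (F q)%:E)%E.
have mG : measurable_fun setT G.
  apply: emeasurable_funM; last exact/measurable_EFinP.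
  apply/measurable_EFinP; apply: (measurableT_comp _ measurable_fst).
  exact: measurable_indic.
have := @indep_gauss_integral G mG _; rewrite /G => H.
transitivity (\int[P]_w ((\1_B (Y w))%:E * (F (Y w, e w))%:E))%E; last first.
  apply: eq_integral => w _; rewrite patchE indicE -(_ : w \in Y @^-1` B = (Y w \in B))//.
  by case: ifP => _; rewrite ?mul1e ?mul0e.
rewrite H; last by move=> q; rewrite mule_ge0// lee_fin.
apply: eq_integral => w _ /=; rewrite ge0_integralZl//.
- rewrite Fpsi patchE indicE -(_ : w \in Y @^-1` B = (Y w \in B))//.
  by case: ifP => _; rewrite ?mul1e ?mul0e.
- exact: (measurableT_comp mFM (pair1_measurable (Y w))).
- by move=> z _; rewrite lee_fin.
Qed.

(** Positive and negative parts are treated separately: F (Y, e) need not be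
    integrable, only its sections are. *)
Lemma is_condE_residual (F : T' * 'cV[R]_n -> R) (psi : T' -> R) :
  measurable_fun setT F ->
  (forall y, (@gauss R k).-integrable setT (fun z => (F (y, M *m z)%R)%:E)) ->
  (forall y, \int[@gauss R k]_z (F (y, M *m z)%R)%:E = (psi y)%:E)%E ->
  is_condE P Y (fun w => F (Y w, e w)) (psi \o Y).
Proof.
move=> mF iF Fpsi.
pose Fp y := fine (\int[@gauss R k]_z (F^\+ (y, M *m z)%R)%:E)%E.
pose Fn y := fine (\int[@gauss R k]_z (F^\- (y, M *m z)%R)%:E)%E.
have Fpfin y : (\int[@gauss R k]_z (F^\+ (y, M *m z)%R)%:E = (Fp y)%:E)%E.
  rewrite fineK// -[X in X \is a _](_ :
    \int[@gauss R k]_z ((fun z => (F (y, M *m z)%R)%:E)^\+ z) = _)%E.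
    exact: integrable_pos_fin_num (iF y).
  by rewrite funerpos.
have Fnfin y : (\int[@gauss R k]_z (F^\- (y, M *m z)%R)%:E = (Fn y)%:E)%E.
  rewrite fineK// -[X in X \is a _](_ :
    \int[@gauss R k]_z ((fun z => (F (y, M *m z)%R)%:E)^\- z) = _)%E.
    exact: integrable_neg_fin_num (iF y).
  by rewrite funerneg.
exists (Fp \o Y), (Fn \o Y); split.
- exact: (is_condE_ge0_residual (measurable_funrpos mF) (fun q => funrpos_ge0 _ _) Fpfin).
- exact: (is_condE_ge0_residual (measurable_funrneg mF) (fun q => funrneg_ge0 _ _) Fnfin).
apply/funext => w /=; apply: EFin_inj.
rewrite -Fpsi EFinB -Fpfin -Fnfin integralE; congr (_ - _)%E.
- by rewrite funerpos.
- by rewrite funerneg.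
Qed.

End residual.
End conditional_expectation.

(** * Conditional moments and densities from a Gaussian residual *)

Section gaussian_residual.
Context {R : realType} d (T : measurableType d) (P : probability T R).

(** M is rectangular so that independent noises can be added by appending columns,
    without extracting a square root of the new covariance. *)
Definition gaussian_residual d' (T' : measurableType d') n (Y : T -> T')
    (V : T -> 'cV[R]_n) (m : T' -> 'cV[R]_n) (Sigma : 'M[R]_n) :=
  exists k (M : 'M[R]_(n, k)),
    M *m M^T = Sigma /\ indep_gauss P Y (fun om => V om - m (Y om)) M.

Context d' (T' : measurableType d') n (Y : T -> T') (V : T -> 'cV[R]_n)
  (m : T' -> 'cV[R]_n) (Sigma : 'M[R]_n).
Hypotheses (mY : measurable_fun setT Y) (mV : measurable_fun setT V)
  (mm : measurable_fun setT m) (VR : gaussian_residual Y V m Sigma).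
Local Notation sY := (g_sigma_algebra_preimageType Y).

Let me : measurable_fun setT (fun om => V om - m (Y om)).
Proof. by apply: measurable_mxB => //; exact: measurableT_comp mm mY. Qed.

Let coordE k (M : 'M[R]_(n, k)) i (z : 'cV[R]_k) : (M *m z) i 0 = (row i M *m z) 0 0.
Proof. by rewrite -row_mul [in RHS]mxE. Qed.

Lemma residual_is_condE_coord i : is_condE P Y (fun om => V om i 0) (fun om => m (Y om) i 0).
Proof.
have [k [M [MM iYe]]] := VR.
have mi : measurable_fun setT (fun y => m y i 0) by have /measurable_fun_matrixP := mm; exact.
pose F (q : T' * 'cV[R]_n) := m q.1 i 0 + q.2 i 0.
have mF : measurable_fun setT F.
  apply: measurable_funD; first exact: measurableT_comp mi measurable_fst.
  exact: measurableT_comp (measurable_matrix_coord i 0) measurable_snd.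
have E y : (fun z => (F (y, M *m z))%:E) =
    (cst (m y i 0)%:E \+ (fun z => ((row i M *m z) 0 0)%:E))%E.
  by apply/funext => z; rewrite /F /= coordE EFinD.
have ic y : (@gauss R k).-integrable setT (cst (m y i 0)%:E).
  exact: finite_measure_integrable_cst.
have := is_condE_residual mY me iYe mF (psi := fun y => m y i 0).
rewrite (_ : (fun w => F _) = (fun om => V om i 0)); last first.
  by apply/funext => w; rewrite /F /= !mxE; ring.
apply => y; rewrite E.
  by apply: integrableD => //; exact: gauss_integrable_lin.
rewrite integralD//; last exact: gauss_integrable_lin.
rewrite gauss_mean adde0 integral_cst// -[RHS]mule1; congr (_ * _)%E.
exact: (@probability_setT _ _ R (@gauss R k)).
Qed.

Lemma residual_is_condE_prod i j :
  is_condE P Y (fun om => (V om - m (Y om)) i 0 * (V om - m (Y om)) j 0)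
    (fun=> Sigma i j).
Proof.
have [k [M [MM iYe]]] := VR.
pose F (q : T' * 'cV[R]_n) := q.2 i 0 * q.2 j 0.
have mF : measurable_fun setT F.
  apply: measurable_funM.
    exact: measurableT_comp (measurable_matrix_coord i 0) measurable_snd.
  exact: measurableT_comp (measurable_matrix_coord j 0) measurable_snd.
apply: (is_condE_residual mY me iYe mF (psi := fun=> Sigma i j)) => y.
  by rewrite /F /=; under eq_fun do rewrite !coordE; exact: gauss_integrable_mul.
rewrite /F /=; under eq_integral do rewrite !coordE.
rewrite gauss_covariance -MM; congr EFin.
by rewrite !mxE; apply: eq_bigr => l _; rewrite !mxE.
Qed.

Lemma residual_has_condE_coord i : has_condE P Y (fun om => V om i 0).
Proof. by eexists; exact: residual_is_condE_coord. Qed.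

Lemma measurable_cond_mean : measurable_fun setT (cond_mean P Y V : sY -> 'cV[R]_n).
Proof.
apply/measurable_fun_matrixP => i j; under eq_fun do rewrite mxE.
exact: is_condE_measurable (condEP (residual_has_condE_coord i)).
Qed.

Lemma residual_cond_mean : {ae P, forall om, cond_mean P Y V om = m (Y om)}.
Proof.
have H i : {ae P, forall om, condE P Y (fun w' => V w' i 0) om = m (Y om) i 0}.
  exact: (is_condE_unique mY (condEP (residual_has_condE_coord i))
    (residual_is_condE_coord i)).
have : {ae P, forall om i, condE P Y (fun w' => V w' i 0) om = m (Y om) i 0}.
  exact: filter_forall.
by apply: filterS => om H1; apply/colP => i; rewrite mxE; exact: H1.
Qed.

(** The deviation is taken from some version of the conditional mean, which agrees
    with m (Y) almost everywhere only. *)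
Lemma residual_is_condE_dev i j : is_condE P Y (cond_dev P Y V i j) (fun=> Sigma i j).
Proof.
apply: is_condE_ae (residual_is_condE_prod i j) => //.
- have /measurable_fun_matrixP me' := me.
  by apply: measurable_funM; exact: me'.
- have mc := measurable_fun_sub_preimage mY measurable_cond_mean.
  have /measurable_fun_matrixP mc' := mc; have /measurable_fun_matrixP mV' := mV.
  by apply: measurable_funM; apply: measurable_funB.
- apply: filterS residual_cond_mean => om E.
  by rewrite /cond_dev E !mxE.
Qed.

Lemma residual_has_cond_moments : has_cond_moments P Y V.
Proof.
split=> [i|i j]; first exact: residual_has_condE_coord.
by eexists; exact: residual_is_condE_dev.
Qed.

Lemma measurable_cond_cov : measurable_fun setT (cond_cov P Y V : sY -> 'M[R]_n).
Proof.
apply/measurable_fun_matrixP => i j; under eq_fun do rewrite mxE.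
exact: is_condE_measurable (condEP (residual_has_cond_moments.2 i j)).
Qed.

Lemma residual_cond_cov : {ae P, forall om, cond_cov P Y V om = Sigma}.
Proof.
have H i j : {ae P, forall om, condE P Y (cond_dev P Y V i j) om = Sigma i j}.
  exact: (is_condE_unique mY (condEP (residual_has_cond_moments.2 i j))
    (residual_is_condE_dev i j)).
have : {ae P, forall om i j, condE P Y (cond_dev P Y V i j) om = Sigma i j}.
  by apply: filter_forall => i; exact: filter_forall.
by apply: filterS => om H1; apply/matrixP => i j; rewrite mxE; exact: H1.
Qed.

Lemma residual_cond_density : posdef Sigma ->
  cond_density P Y V
    (fun om => gaussian_pdf (cond_mean P Y V om) (cond_cov P Y V om)).
Proof.
move=> Spos; have [k [M [MM iYe]]] := VR.
have mc := measurable_cond_mean; have mC := measurable_cond_cov.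
have pdf0 (mu z : 'cV[R]_n) S : 0 <= gaussian_pdf mu S z by rewrite divr_ge0 ?expR_ge0.
split=> [|om z //|A B mA mB].
  apply: measurable_gaussian_pdf; last exact: measurable_snd.
    exact: (measurableT_comp mc measurable_fst).
  exact: (measurableT_comp mC measurable_fst).
have mYB : measurable (Y @^-1` B) by exact: measurable_preimage mB.
pose G (q : T' * 'cV[R]_n) : \bar R := ((\1_B q.1)%:E * (\1_A (m q.1 + q.2))%:E)%E.
have mG : measurable_fun setT G.
  apply: emeasurable_funM; apply/measurable_EFinP.
    by apply: (measurableT_comp _ measurable_fst); exact: measurable_indic.
  have mI : measurable_fun setT (\1_A : 'cV[R]_n -> R) by exact: measurable_indic.
  apply: (measurableT_comp mI).
  apply: measurable_mxD; last exact: measurable_snd.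
  exact: measurableT_comp mm measurable_fst.
have mAM y : measurable [set z | A (m y + M *m z)].
  apply: measurable_preimage mA; apply: measurable_mxD => //.
  exact: measurable_mulmxl.
have := indep_gauss_integral mY me iYe mG _.
rewrite /G /= => H.
have mVA : measurable (V @^-1` A) by exact: measurable_preimage mA.
transitivity (\int[P]_w ((\1_B (Y w))%:E * (\1_A (V w))%:E))%E.
  rewrite -(setIT (V @^-1` A `&` _)) -integral_indic//; last exact: measurableI.
  apply: eq_integral => w _; rewrite -EFinM; congr EFin.
  rewrite !indicE in_setI -natrM mulnb andbC.
  by congr (_ && _)%:R.
under eq_integral => w _.
  rewrite -{1}(_ : m (Y w) + (V w - m (Y w)) = V w); last by rewrite addrC subrK.
  over.
rewrite H; last by move=> q; rewrite mule_ge0// lee_fin.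
transitivity (\int[P]_(w in Y @^-1` B) \int[lebesgue_cV n]_(z in A)
   (gaussian_pdf (m (Y w)) Sigma z)%:E)%E.
  rewrite [RHS]integral_mkcond; apply: eq_integral => w _.
  rewrite patchE (integral_gaussian_pdf (m (Y w)) Spos MM mA).
  rewrite ge0_integralZl//; last first.
    apply/measurable_EFinP.
    have mI : measurable_fun setT (\1_A : 'cV[R]_n -> R) by exact: measurable_indic.
    apply: (measurableT_comp mI); apply: measurable_mxD => //.
    exact: measurable_mulmxl.
  have := integral_indic (@gauss R k) measurableT (mAM (Y w)).
  rewrite setIT => <-.
  rewrite indicE -(_ : w \in Y @^-1` B = (Y w \in B))//.
  by case: ifP => _; rewrite ?mul1e ?mul0e.
have mint (mu : T -> 'cV[R]_n) (S : T -> 'M[R]_n) :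
    measurable_fun setT mu -> measurable_fun setT S ->
    measurable_fun (Y @^-1` B)
      (fun w => \int[lebesgue_cV n]_(z in A) (gaussian_pdf (mu w) (S w) z)%:E)%E.
  move=> mmu mS; apply: measurable_funTS.
  under eq_fun do rewrite integral_mkcond.
  apply: (measurable_fun_fubini_tonelli_F (fun q : T * 'cV[R]_n =>
    ((fun z => (gaussian_pdf (mu q.1) (S q.1) z)%:E) \_ A) q.2)%E).
    apply: (measurable_patch (A := snd @^-1` A)
      (f := fun q : T * 'cV[R]_n => (gaussian_pdf (mu q.1) (S q.1) q.2)%:E)).
      exact: measurable_preimage measurable_snd mA.
    apply/measurable_EFinP; apply: measurable_gaussian_pdf.
    - exact: measurableT_comp mmu measurable_fst.
    - exact: measurableT_comp mS measurable_fst.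
    - exact: measurable_snd.
  by move=> q; apply: erestrict_ge0 => z _; rewrite lee_fin.
apply: ge0_ae_eq_integral => //.
- by apply: mint => //; exact: measurableT_comp mm mY.
- apply: mint.
    exact: (measurable_fun_sub_preimage mY mc).
  exact: (measurable_fun_sub_preimage mY mC).
- by move=> w _; apply: integral_ge0 => z _; rewrite lee_fin.
- by move=> w _; apply: integral_ge0 => z _; rewrite lee_fin.
- by apply: filterS2 residual_cond_mean residual_cond_cov => w /= -> ->.
Qed.

End gaussian_residual.

(** * Positive definiteness, the gain and the two update steps *)

Section positive_definite.
Context {R : realType}.
Implicit Types n p k : nat.

Lemma tr_mul_self_ge0 n (u : 'cV[R]_n) : 0 <= (u^T *m u) 0 0.
Proof. by rewrite mxE sumr_ge0// => i _; rewrite mxE -expr2 sqr_ge0. Qed.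

Lemma posdef_ge0 n (S : 'M[R]_n) (z : 'cV[R]_n) : posdef S ->
  0 <= (z^T *m S *m z) 0 0.
Proof.
move=> [_ Sp]; have [->|/Sp/ltW//] := eqVneq z 0.
by rewrite mulmx0 mxE.
Qed.

Lemma posdef_unitmx n (S : 'M[R]_n) : posdef S -> S \in unitmx.
Proof. by move=> /cholesky[L [<- Lu _]]; rewrite unitmx_mul unitmx_tr Lu. Qed.

Lemma posdef_gramD n k (M : 'M[R]_(n, k)) (S : 'M[R]_n) : posdef S ->
  posdef (M *m M^T + S).
Proof.
move=> [ST Sp]; split=> [|z /Sp z0].
  by rewrite linearD /= trmx_mul trmxK ST.
rewrite mulmxDr mulmxDl mxE ltr_wpDl//.
have := tr_mul_self_ge0 (M^T *m z).
by rewrite trmx_mul trmxK !mulmxA.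
Qed.

End positive_definite.

Section gain.
Context {R : realType} (n p : nat) (C : 'M[R]_(p, n)) (Sv : 'M[R]_p) (Sigma : 'M[R]_n).
Hypotheses (ST : Sigma^T = Sigma) (SvT : Sv^T = Sv).
Hypothesis (Nu : C *m Sigma *m C^T + Sv \in unitmx).

Definition gain := Sigma *m C^T *m invmx (C *m Sigma *m C^T + Sv).

(** The error e - gain *m (C *m e + v) and the innovation C *m e + v are
    uncorrelated. *)
Lemma gain_orthogonal : (1%:M - gain *m C) *m Sigma *m C^T = gain *m Sv.
Proof.
have KN : gain *m (C *m Sigma *m C^T + Sv) = Sigma *m C^T by rewrite mulmxKV.
rewrite mulmxBl mul1mx mulmxBl -{1}KN mulmxDr -!mulmxA.
by rewrite addrAC subrr add0r.
Qed.

(** The left-hand side is the covariance of the error e - gain *m (C *m e + v), in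
    a form that shows its positivity. *)
Lemma joseph_form : (1%:M - gain *m C) *m Sigma *m (1%:M - gain *m C)^T +
  gain *m Sv *m gain^T = update_cov C Sv Sigma.
Proof.
rewrite linearB /= trmx1 trmx_mul mulmxBr mulmx1 mulmxA gain_orthogonal subrK.
by rewrite mulmxBl mul1mx.
Qed.

End gain.

(** In the Joseph form, the second term is positive at z unless gain^T z = 0, and
    then the first term is the value of Sigma at z. *)
Lemma posdef_update_cov {R : realType} n p (C : 'M[R]_(p, n)) (Sv : 'M[R]_p)
    (Sigma : 'M[R]_n) : posdef Sigma -> posdef Sv -> posdef (update_cov C Sv Sigma).
Proof.
move=> Sp Svp; have [L [LL _ _]] := cholesky Sp.
have [ST S0] := Sp; have [SvT Sv0] := Svp.
have Nu : C *m Sigma *m C^T + Sv \in unitmx.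
  rewrite -LL (_ : C *m (L *m L^T) *m C^T = (C *m L) *m (C *m L)^T).
    exact/posdef_unitmx/posdef_gramD.
  by rewrite trmx_mul !mulmxA.
rewrite -joseph_form//; move: (gain C Sv Sigma) => K; split=> [|z z0].
  by rewrite linearD /= !trmx_mul !trmxK ST SvT !mulmxA.
rewrite mulmxDr mulmxDl mxE.
have E1 : z^T *m ((1%:M - K *m C) *m Sigma *m (1%:M - K *m C)^T) *m z =
    ((1%:M - K *m C)^T *m z)^T *m Sigma *m ((1%:M - K *m C)^T *m z).
  by rewrite trmx_mul trmxK !mulmxA.
have E2 : z^T *m (K *m Sv *m K^T) *m z = (K^T *m z)^T *m Sv *m (K^T *m z).
  by rewrite trmx_mul trmxK !mulmxA.
rewrite E1 E2; have [Kz|Kz] := eqVneq (K^T *m z) 0.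
  rewrite Kz mulmx0 [X in _ + X]mxE addr0.
  rewrite (_ : (1%:M - K *m C)^T *m z = z); first exact: S0.
  by rewrite linearB /= trmx1 trmx_mul mulmxBl mul1mx -mulmxA Kz mulmx0 subr0.
by rewrite ltr_wpDl ?posdef_ge0//; exact: Sv0.
Qed.

Section kalman_steps.
Context {R : realType} d (T : measurableType d) (P : probability T R).
Context d' (T' : measurableType d') n (Y : T -> T') (V : T -> 'cV[R]_n)
  (m : T' -> 'cV[R]_n) (Sigma : 'M[R]_n).
Hypotheses (mY : measurable_fun setT Y) (mV : measurable_fun setT V)
  (mm : measurable_fun setT m) (VR : gaussian_residual P Y V m Sigma).

Let me : measurable_fun setT (fun om => V om - m (Y om)).
Proof. by apply: measurable_mxB => //; exact: measurableT_comp mm mY. Qed.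

Let indep_residual q l (w : T -> 'cV[R]_q) (S : 'M[R]_(q, l)) :
  indep_gauss P (fun om => (Y om, V om)) w S ->
  indep_gauss P (fun om => (Y om, V om - m (Y om))) w S.
Proof.
apply: (@indep_gauss_comp _ _ _ P _ _ _ _ _ _ (fun om => (Y om, V om))
  (fun q : T' * 'cV[R]_n => (q.1, q.2 - m q.1))).
apply: measurable_fun_pair; first exact: measurable_fst.
apply: measurable_mxB; first exact: measurable_snd.
exact: measurableT_comp mm measurable_fst.
Qed.

(** The known shift h (Y) goes into the mean; the error becomes A e + w. *)
Lemma time_update l (A : 'M[R]_n) (h : T' -> 'cV[R]_n) (w : T -> 'cV[R]_n)
    (S : 'M[R]_(n, l)) (V' : T -> 'cV[R]_n) :
  measurable_fun setT w -> indep_gauss P (fun om => (Y om, V om)) w S ->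
  (forall om, V' om = A *m V om + h (Y om) + w om) ->
  gaussian_residual P Y V' (fun y => A *m m y + h y) (A *m Sigma *m A^T + S *m S^T).
Proof.
move=> mw iw V'E; have [k [M [MM iYe]]] := VR.
exists (k + l)%N, (row_mx (A *m M) (1%:M *m S)); split.
  by rewrite tr_row_mx mul_row_col trmx_mul mul1mx -MM !mulmxA.
have := indep_gauss_lin A 1%:M mY me mw iYe (indep_residual iw).
congr indep_gauss; apply/funext => om.
rewrite V'E mul1mx mulmxBr opprD [RHS]addrACA; apply/colP => i; rewrite !mxE; ring.
Qed.

(** The new error is e - K nu with nu = C e + v, independent of (Y, nu) by
    [indep_gauss_condition]; and (Y, y), hence the new data H (Y, y), is a function
    of (Y, nu). *)
Lemma measurement_update p l d2 (T2 : measurableType d2) (C : 'M[R]_(p, n))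
    (Sv : 'M[R]_p) (v y : T -> 'cV[R]_p) (S : 'M[R]_(p, l))
    (H : T' * 'cV[R]_p -> T2) (m2 : T2 -> 'cV[R]_n) :
  posdef Sv -> S *m S^T = Sv ->
  measurable_fun setT v -> indep_gauss P (fun om => (Y om, V om)) v S ->
  (forall om, y om = C *m V om + v om) ->
  measurable_fun setT H ->
  (forall a b, m2 (H (a, b)) = update_mean C Sv (m a) Sigma b) ->
  gaussian_residual P (fun om => H (Y om, y om)) V m2 (update_cov C Sv Sigma).
Proof.
move=> Svp SS mv iv yE mH m2H; have [k [M [MM iYe]]] := VR.
have ST : Sigma^T = Sigma by rewrite -MM trmx_mul trmxK.
have Nu : C *m Sigma *m C^T + Sv \in unitmx.
  rewrite -MM (_ : C *m (M *m M^T) *m C^T = (C *m M) *m (C *m M)^T).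
    exact/posdef_unitmx/posdef_gramD.
  by rewrite trmx_mul !mulmxA.
have ie := indep_residual iv; pose K := gain C Sv Sigma.
have KO : (1%:M - K *m C) *m Sigma *m C^T = K *m Sv by exact: gain_orthogonal.
have KJ : (1%:M - K *m C) *m Sigma *m (1%:M - K *m C)^T + K *m Sv *m K^T =
  update_cov C Sv Sigma by exact: joseph_form.
have KU a b : m2 (H (a, b)) = m a + K *m (b - C *m m a) by exact: m2H.
clearbody K; pose J := 1%:M - K *m C; rewrite -/J in KO KJ.
have JE u : J *m u = u - K *m (C *m u) by rewrite mulmxBl mul1mx mulmxA.
clearbody J.
pose M1 := row_mx (J *m M) (- K *m S).
pose M2 := row_mx (C *m M) (1%:M *m S).
have M12 : M1 *m M2^T = 0.
  rewrite tr_row_mx mul_row_col mul1mx !mulNmx -(mulmxA K) SS trmx_mul.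
  by rewrite mulmxA -(mulmxA J) MM KO subrr.
have M22 : M2 *m M2^T \in unitmx.
  rewrite tr_row_mx mul_row_col mul1mx SS trmx_mul.
  by rewrite mulmxA -(mulmxA C) MM.
exists (k + l)%N, M1; split.
  rewrite -KJ tr_row_mx mul_row_col mulNmx [(- _)^T]linearN /= mulNmx mulmxN opprK.
  by rewrite !trmx_mul !mulmxA -(mulmxA J M) MM -(mulmxA K S) SS.
have := indep_gauss_condition M12 M22 mY me mv iYe ie.
pose h (q : T' * 'cV[R]_p) := H (q.1, C *m m q.1 + q.2).
have mh : measurable_fun setT h.
  apply: (measurableT_comp mH); apply: measurable_fun_pair; first exact: measurable_fst.
  apply: measurable_mxD; last exact: measurable_snd.
  by apply: measurable_mulmxl; exact: measurableT_comp mm measurable_fst.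
move/(indep_gauss_comp mh).
have hE om : h (Y om, C *m (V om - m (Y om)) + 1%:M *m v om) = H (Y om, y om).
  rewrite /h /= yE mul1mx mulmxBr; congr (H (_, _)).
  by rewrite addrA [X in X + _]addrC subrK.
have EE om : J *m (V om - m (Y om)) + - K *m v om = V om - m2 (H (Y om, y om)).
  rewrite KU yE JE mulNmx !(mulmxBr, mulmxDr).
  by apply/colP => i; rewrite ![in LHS]mxE ![in RHS]mxE; ring.
congr indep_gauss; apply/funext => om; [exact: hE|exact: EE].
Qed.

End kalman_steps.

(** * Output matrices, the recursion and histories of noises *)

Section output_history.
Context {R : realType} (p : nat).

Definition snoc_mx t (q : 'M[R]_(p, t) * 'cV[R]_p) : 'M[R]_(p, t.+1) :=
  \matrix_(i, k) oapp (fun j => q.1 i j) (q.2 i 0) (unlift ord_max k).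

Definition init_mx t (Y : 'M[R]_(p, t.+1)) : 'M[R]_(p, t) :=
  \matrix_(i, k) Y i (lift ord_max k).

Definition last_mx t (Y : 'M[R]_(p, t.+1)) : 'cV[R]_p := \col_i Y i ord_max.

Lemma init_snoc_mx t (a : 'M[R]_(p, t)) b : init_mx (snoc_mx (a, b)) = a.
Proof. by apply/matrixP => i j; rewrite !mxE liftK. Qed.

Lemma last_snoc_mx t (a : 'M[R]_(p, t)) b : last_mx (snoc_mx (a, b)) = b.
Proof. by apply/colP => i; rewrite !mxE unlift_none. Qed.

Lemma measurable_snoc_mx t : measurable_fun setT (@snoc_mx t).
Proof.
apply/measurable_fun_matrixP => i j; under eq_fun do rewrite mxE.
case: (unliftP ord_max j) => [k|] _ /=.
  exact: measurableT_comp (measurable_matrix_coord i k) measurable_fst.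
exact: measurableT_comp (measurable_matrix_coord i 0) measurable_snd.
Qed.

Lemma measurable_init_mx t : measurable_fun setT (@init_mx t).
Proof.
apply/measurable_fun_matrixP => i j; under eq_fun do rewrite mxE.
exact: measurable_matrix_coord.
Qed.

Lemma measurable_last_mx t : measurable_fun setT (@last_mx t).
Proof.
apply/measurable_fun_matrixP => i j; under eq_fun do rewrite mxE.
exact: measurable_matrix_coord.
Qed.

Definition past_outputs T (y : nat -> T -> 'cV[R]_p) t (om : T) : 'M[R]_(p, t) :=
  \matrix_(i, k) y k om i 0.

Lemma outputsE T (y : nat -> T -> 'cV[R]_p) t om :
  outputs y t om = snoc_mx (past_outputs y t om, y t om).
Proof.
apply/matrixP => i j; rewrite !mxE.
case: (unliftP ord_max j) => [k|] ->; last by [].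
by rewrite /= mxE; congr (y _ om i 0); exact: lift_max.
Qed.

End output_history.

Section kalman_recursion.
Context {R : realType} (n m p : nat) (A : 'M[R]_n) (B : 'M[R]_(n, m))
  (C : 'M[R]_(p, n)) (Sx0 Sw : 'M[R]_n) (Sv : 'M[R]_p)
  (g : forall t, 'M[R]_(p, t.+1) -> 'cV[R]_m).

Fixpoint predicted_cov t : 'M[R]_n :=
  if t is t'.+1 then A *m update_cov C Sv (predicted_cov t') *m A^T + Sw else Sx0.

Fixpoint predicted_mean t : 'M[R]_(p, t) -> 'cV[R]_n :=
  match t with
  | 0 => fun=> 0
  | t'.+1 => fun Y => A *m update_mean C Sv (predicted_mean (init_mx Y))
      (predicted_cov t') (last_mx Y) + B *m g Y
  end.

Definition filtered_mean t (Y : 'M[R]_(p, t.+1)) : 'cV[R]_n :=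
  update_mean C Sv (predicted_mean (init_mx Y)) (predicted_cov t) (last_mx Y).

Hypothesis mg : forall t, measurable_fun setT (@g t).

Lemma measurable_filtered_mean t :
  measurable_fun setT (@predicted_mean t) -> measurable_fun setT (@filtered_mean t).
Proof.
move=> mp; have mi := measurableT_comp mp (measurable_init_mx (p := p) (t := t)).
apply: measurable_mxD => //; apply: measurable_mulmxl.
apply: measurable_mxB; first exact: measurable_last_mx.
exact: measurable_mulmxl.
Qed.

Lemma measurable_predicted_mean t : measurable_fun setT (@predicted_mean t).
Proof.
elim: t => [|t ih]; first exact: measurable_cst.
apply: measurable_mxD; apply: measurable_mulmxl; last exact: mg.
exact: measurable_filtered_mean.
Qed.

End kalman_recursion.

Section history.
Context {R : realType} d (T : measurableType d) (P : probability T R)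
  (I : eqType) (F : I -> set (set T)).
Hypotheses (indep : mutually_independent P F) (Fm : forall i, F i `<=` measurable)
  (FT : forall i, F i setT) (FI : forall i, setI_closed (F i)).

(** The sample space with the information carried by the indices in s.  Working
    with sub-sigma-algebras avoids vectors whose size grows with time. *)
Definition history (s : seq I) := g_sigma_algebraType (\bigcup_(i in [set` s]) F i).

Lemma history_sub s s' d' (U : measurableType d') (f : T -> U) :
  {subset s <= s'} -> measurable_fun setT (f : history s -> U) ->
  measurable_fun setT (f : history s' -> U).
Proof.
move=> ss' mf _ D mD; have := mf measurableT D mD.
apply: sub_sigma_algebra2 => E [i si FE]; exists i => //; exact: ss'.
Qed.

Lemma history_measurable s d' (U : measurableType d') (f : T -> U) :
  measurable_fun setT (f : history s -> U) -> measurable_fun setT f.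
Proof.
move=> mf _ D mD; have := mf measurableT D mD.
apply: smallest_sub; first exact: sigma_algebra_measurable.
by move=> E [i si]; exact: Fm.
Qed.

Lemma history_gen s i d' (U : measurableType d') (f : T -> U) : i \in s ->
  g_sigma_algebra_preimage f `<=` F i -> measurable_fun setT (f : history s -> U).
Proof.
move=> si fF _ D mD; apply: sub_sigma_algebra; exists i => //.
by apply: fF; exists D.
Qed.

Lemma history_indep_gauss s j d' (U : measurableType d') (f : T -> U) q
    (e : T -> 'cV[R]_q) (S : 'M[R]_q) :
  uniq s -> j \notin s -> measurable_fun setT (f : history s -> U) ->
  g_sigma_algebra_preimage e `<=` F j ->
  (forall D, measurable D -> P (e @^-1` D) = gauss [set z | D (S *m z)]) ->
  indep_gauss P f e S.
Proof.
move=> us js mf eF eS D1 D2 mD1 mD2; rewrite -eS// muleC setIC.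
apply: (mutually_independent_join indep Fm FT FI us js).
  by apply: eF; exists D2 => //; rewrite setTI.
have := mf measurableT D1 mD1; by rewrite setTI.
Qed.

End history.

(** * The residual along the closed loop *)

Unset Implicit Arguments.

Section kalman_filter.
Context {R : realType} d (T : measurableType d) (P : probability T R) (n m p : nat)
  (A : 'M[R]_n) (B : 'M[R]_(n, m)) (C : 'M[R]_(p, n))
  (Sx0 Sw : 'M[R]_n) (Sv : 'M[R]_p)
  (x0 : T -> 'cV[R]_n) (w : nat -> T -> 'cV[R]_n) (v : nat -> T -> 'cV[R]_p)
  (g : forall t : nat, 'M[R]_(p, t.+1) -> 'cV[R]_m)
  (x : nat -> T -> 'cV[R]_n) (u : nat -> T -> 'cV[R]_m) (y : nat -> T -> 'cV[R]_p).
Hypotheses (hSw : posdef Sw) (hSv : posdef Sv)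
  (mx0 : measurable_fun setT x0) (mw : forall t, measurable_fun setT (w t))
  (mv : forall t, measurable_fun setT (v t))
  (hx0 : gaussian_law P x0 0 Sx0) (hw : forall t, gaussian_law P (w t) 0 Sw)
  (hv : forall t, gaussian_law P (v t) 0 Sv)
  (hindep : mutually_independent P (noise_sigma_algebra x0 w v))
  (hg : forall t, measurable_fun setT (g t))
  (hinit : forall om, x 0%N om = x0 om)
  (hstate : forall t om, x t.+1 om = A *m x t om + B *m u t om + w t om)
  (hout : forall t om, y t om = C *m x t om + v t om)
  (hfeed : forall t om, u t om = g t (outputs y t om)).
Local Notation F := (noise_sigma_algebra x0 w v).
Local Notation hist := (history F).
Local Notation pmean := (predicted_mean A B C Sx0 Sw Sv g).
Local Notation pcov := (predicted_cov A C Sx0 Sw Sv).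
Local Notation fmean := (filtered_mean A B C Sx0 Sw Sv g).

Let Fm i : F i `<=` measurable.
Proof.
move=> E; case: i => [[]|[t|t]] [D mD <-]; rewrite setTI.
- exact: measurable_preimage mD.
- exact: measurable_preimage mD.
- exact: measurable_preimage mD.
Qed.

Let g_preimage_setT q (e : T -> 'cV[R]_q) : g_sigma_algebra_preimage e setT.
Proof. by exists setT => //; rewrite preimage_setT setTI. Qed.

Let g_preimage_setI q (e : T -> 'cV[R]_q) : setI_closed (g_sigma_algebra_preimage e).
Proof.
move=> _ _ [D mD <-] [E mE <-]; exists (D `&` E); first exact: measurableI.
by rewrite !setTI preimage_setI.
Qed.

Let FT i : F i setT.
Proof. by case: i => [[]|[t|t]]; exact: g_preimage_setT. Qed.

Let FI i : setI_closed (F i).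
Proof. by case: i => [[]|[t|t]]; exact: g_preimage_setI. Qed.

Let law q (e : T -> 'cV[R]_q) Sigma : gaussian_law P e 0 Sigma ->
  exists2 S : 'M[R]_q, S *m S^T = Sigma &
    forall D, measurable D -> P (e @^-1` D) = gauss [set z | D (S *m z)].
Proof.
move=> [S SS eS]; exists S => // D mD; rewrite eS// /gauss.
by congr integral; apply/seteqP; split => z /=; rewrite add0r.
Qed.

(** The noises on which the state at time t and the outputs before t depend. *)
Definition noise_before t : seq (unit + (nat + nat)) :=
  inl tt :: [seq inr (inl k) | k <- iota 0 t] ++ [seq inr (inr k) | k <- iota 0 t].

Lemma uniq_noise_before t : uniq (noise_before t).
Proof.
rewrite /= cat_uniq !map_inj_uniq ?iota_uniq//=; try by move=> ? ? [].
rewrite andbT mem_cat negb_or.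
apply/andP; split; first by apply/andP; split; apply/negP => /mapP[].
by apply/hasPn => _ /mapP[k _ ->]; apply/negP => /mapP[].
Qed.

Lemma mem_noise_before t i : (i \in noise_before t) =
  match i with inl _ => true | inr (inl k) | inr (inr k) => (k < t)%N end.
Proof.
case: i => [[]|[k|k]]; rewrite inE //= mem_cat.
  rewrite mem_map => [|a b []//]; rewrite mem_iota add0n.
  by rewrite [X in _ || X](_ : _ = false) ?orbF//; apply/negP => /mapP[].
rewrite orbC mem_map => [|a b []//]; rewrite mem_iota add0n.
by rewrite [X in _ || X](_ : _ = false) ?orbF//; apply/negP => /mapP[].
Qed.

Lemma v_notin_noise_before t : inr (inr t) \notin noise_before t.
Proof. by rewrite mem_noise_before ltnn. Qed.

Lemma w_notin_noise t : inr (inl t) \notin inr (inr t) :: noise_before t.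
Proof. by rewrite in_cons mem_noise_before ltnn. Qed.

Let mcv s q r (M : 'M[R]_(q, r)) (f : T -> 'cV[R]_r) :
  measurable_fun setT (f : hist s -> _) ->
  measurable_fun setT ((fun om => M *m f om) : hist s -> _).
Proof. exact: measurable_mulmxl. Qed.

Lemma history_outputs t :
  measurable_fun setT (x t : hist (noise_before t) -> _) ->
  measurable_fun setT (past_outputs y t : hist (noise_before t) -> _) ->
  measurable_fun setT (outputs y t : hist (inr (inr t) :: noise_before t) -> _).
Proof.
move=> mx mY.
have sub : {subset noise_before t <= inr (inr t) :: noise_before t}.
  by move=> i it; rewrite inE it orbT.
have mx' := history_sub sub mx; have mY' := history_sub sub mY.
have mv' : measurable_fun setT (v t : hist (inr (inr t) :: noise_before t) -> _).
  by apply: (@history_gen _ _ _ _ _ (inr (inr t))); rewrite ?mem_head.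
rewrite (_ : outputs y t = (fun om => snoc_mx (past_outputs y t om, C *m x t om + v t om))).
  apply: (measurableT_comp (@measurable_snoc_mx R p t)).
  by apply: measurable_fun_pair => //; apply: measurable_mxD => //; exact: mcv.
by apply/funext => om; rewrite outputsE hout.
Qed.

Lemma history_state t :
  measurable_fun setT (x t : hist (noise_before t) -> _) /\
  measurable_fun setT (past_outputs y t : hist (noise_before t) -> _).
Proof.
elim: t => [|t [mx mY]].
  split.
    rewrite (_ : x 0%N = x0); last exact/funext.
    by apply: (@history_gen _ _ _ _ _ (inl tt)); rewrite ?mem_head.
  apply/measurable_fun_matrixP => i; by case.
have sub : {subset inr (inr t) :: noise_before t <= noise_before t.+1}.
  move=> i; rewrite in_cons !mem_noise_before => /orP[/eqP -> //|].
  by case: i => [//|[k|k]] /ltnW.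
have mO := history_sub sub (history_outputs t mx mY).
have sub' : {subset noise_before t <= noise_before t.+1}.
  by move=> i it; apply: sub; rewrite inE it orbT.
have mx' := history_sub sub' mx.
have mw' : measurable_fun setT (w t : hist (noise_before t.+1) -> _).
  by apply: (@history_gen _ _ _ _ _ (inr (inl t))); rewrite ?mem_noise_before.
split; last exact: mO.
rewrite (_ : x t.+1 = (fun om => A *m x t om + B *m g t (outputs y t om) + w t om)).
  apply: measurable_mxD => //; apply: measurable_mxD; apply: mcv => //.
  exact: (measurableT_comp (hg t) mO).
by apply/funext => om; rewrite hstate hfeed.
Qed.

Lemma measurable_state t : measurable_fun setT (x t).
Proof. exact: (history_measurable Fm (history_state t).1). Qed.

Lemma measurable_past_outputs t : measurable_fun setT (past_outputs y t).
Proof. exact: (history_measurable Fm (history_state t).2). Qed.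

Lemma filtered_residual t :
  gaussian_residual P (past_outputs y t) (x t) (@pmean t) (pcov t) ->
  gaussian_residual P (outputs y t) (x t) (@fmean t) (update_cov C Sv (pcov t)).
Proof.
move=> VR; have [S SS vS] := law _ _ _ (hv t).
have [mx mY] := history_state t.
have iv : indep_gauss P (fun om => (past_outputs y t om, x t om)) (v t) S.
  apply: (history_indep_gauss hindep Fm FT FI (uniq_noise_before t) (v_notin_noise_before t)) => //.
  exact: measurable_fun_pair.
have := measurement_update (measurable_past_outputs t) (measurable_state t)
  (measurable_predicted_mean A B C Sx0 Sw Sv hg (t := t)) VR hSv SS (mv t) iv (hout t)
  (@measurable_snoc_mx R p t) (m2 := @fmean t).
rewrite (_ : (fun om => snoc_mx _) = outputs y t).
  by apply => a b; rewrite /filtered_mean init_snoc_mx last_snoc_mx.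
by apply/funext => om; rewrite outputsE.
Qed.

Lemma predicted_residualS t :
  gaussian_residual P (outputs y t) (x t) (@fmean t) (update_cov C Sv (pcov t)) ->
  gaussian_residual P (outputs y t) (x t.+1) (@pmean t.+1) (pcov t.+1).
Proof.
move=> VR; have [S SS wS] := law _ _ _ (hw t).
have [mx mY] := history_state t; have mO := history_outputs t mx mY.
have iw : indep_gauss P (fun om => (outputs y t om, x t om)) (w t) S.
  have un : uniq (inr (inr t) :: noise_before t).
    by rewrite /= v_notin_noise_before; exact: uniq_noise_before.
  apply: (history_indep_gauss hindep Fm FT FI un (w_notin_noise t)) => //.
  apply: measurable_fun_pair => //; apply: history_sub mx => i it.
  by rewrite inE it orbT.
have := time_update (h := fun Y => B *m g t Y) (V' := x t.+1) (A := A)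
  (measurable_past_outputs t.+1) (measurable_state t)
  (measurable_filtered_mean (measurable_predicted_mean A B C Sx0 Sw Sv hg (t := t))) VR (mw t) iw.
rewrite SS; apply => om; by rewrite hstate hfeed.
Qed.

(** At time 0 there are no outputs yet, so independence from them is trivial. *)
Lemma predicted_residual t :
  gaussian_residual P (past_outputs y t) (x t) (@pmean t) (pcov t).
Proof.
elim: t => [|t ih]; last exact: predicted_residualS (filtered_residual t ih).
have [S SS x0S] := law _ _ _ hx0; exists n, S; split => // D E mD mE.
have -> : (fun om => x 0%N om - @pmean 0 (past_outputs y 0 om)) = x0.
  by apply/funext => om; rewrite hinit /= subr0.
rewrite -x0S//.
pose a : 'M[R]_(p, 0) := 0.
have aE om : past_outputs y 0 om = a by apply/matrixP => i [].
(* Matrices without columns are all equal, so D is either certain or impossible. *)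
have [Da|Da] := pselect (D a).
  rewrite (_ : _ @^-1` D = setT) ?setTI ?probability_setT ?mul1e//.
  by apply/seteqP; split => om //= _; rewrite aE.
rewrite (_ : _ @^-1` D = set0) ?set0I ?measure0 ?mul0e//.
by apply/seteqP; split => om //=; rewrite aE.
Qed.

End kalman_filter.

Theorem proposition3 (R : realType) (d : measure_display) (T : measurableType d)
    (P : probability T R) (n m p : nat)
    (A : 'M[R]_n) (B : 'M[R]_(n, m)) (C : 'M[R]_(p, n))
    (Sx0 Sw : 'M[R]_n) (Sv : 'M[R]_p)
    (x0 : {RV P >-> 'cV[R]_n}) (w : nat -> {RV P >-> 'cV[R]_n})
    (v : nat -> {RV P >-> 'cV[R]_p})
    (g : forall t : nat, 'M[R]_(p, t.+1) -> 'cV[R]_m)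
    (x : nat -> T -> 'cV[R]_n) (u : nat -> T -> 'cV[R]_m)
    (y : nat -> T -> 'cV[R]_p)
    (hSw : posdef Sw) (hSv : posdef Sv)
    (hx0 : gaussian_law P x0 0 Sx0)
    (hw : forall t, gaussian_law P (w t) 0 Sw)
    (hv : forall t, gaussian_law P (v t) 0 Sv)
    (hindep : mutually_independent P (noise_sigma_algebra x0 w v))
    (hg : forall t, measurable_fun setT (g t))
    (hinit : forall om, x 0%N om = x0 om)
    (hstate : forall t om, x t.+1 om = A *m x t om + B *m u t om + w t om)
    (hout : forall t om, y t om = C *m x t om + v t om)
    (hfeed : forall t om, u t om = g t (outputs y t om)) :
  (* xhat t s and Pcov t s: conditional mean and covariance of x_t given Y_s *)
  let xhat t s := cond_mean P (outputs y s) (x t) in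
  let Pcov t s := cond_cov P (outputs y s) (x t) in
  [/\ forall t, has_cond_moments P (outputs y t) (x t) /\
                has_cond_moments P (outputs y t) (x t.+1),
      (* singular Sx0 : x_0 given y_0 has no density *)
      forall t, (t = 0%N -> posdef Sx0) ->
        {ae P, forall om, posdef (Pcov t t om)} /\
        cond_density P (outputs y t) (x t)
          (fun om => gaussian_pdf (xhat t t om) (Pcov t t om)),
      forall t,
        {ae P, forall om, posdef (Pcov t.+1 t om)} /\
        cond_density P (outputs y t) (x t.+1)
          (fun om => gaussian_pdf (xhat t.+1 t om) (Pcov t.+1 t om)),
      {ae P, forall om,
        xhat 0%N 0%N om = update_mean C Sv 0 Sx0 (y 0%N om) /\
        Pcov 0%N 0%N om = update_cov C Sv Sx0} &
      forall t, {ae P, forall om,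
        [/\ xhat t.+1 t om = A *m xhat t t om + B *m g t (outputs y t om),
            Pcov t.+1 t om = A *m Pcov t t om *m A^T + Sw,
            xhat t.+1 t.+1 om =
              update_mean C Sv (xhat t.+1 t om) (Pcov t.+1 t om) (y t.+1 om) &
            Pcov t.+1 t.+1 om = update_cov C Sv (Pcov t.+1 t om)]}].
Proof.
move=> xhat Pcov.
have mx0 : measurable_fun setT x0 by [].
have mw t : measurable_fun setT (w t) by [].
have mv t : measurable_fun setT (v t) by [].
have mX t : measurable_fun setT (x t).
  exact: (measurable_state _ _ _ _ _ A B C x0 w v g x u y mx0 mw mv hg hinit hstate hout hfeed t).
have mO t : measurable_fun setT (outputs y t).
  exact: (measurable_past_outputs _ _ _ _ _ A B C x0 w v g x u y mx0 mw mv hg hinit hstate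
    hout hfeed t.+1).
pose pm := @predicted_mean R n m p A B C Sx0 Sw Sv g.
pose fm := @filtered_mean R n m p A B C Sx0 Sw Sv g.
pose pc := @predicted_cov R n p A C Sx0 Sw Sv.
pose fc t := update_cov C Sv (pc t).
have mpm t : measurable_fun setT (pm t) by exact: measurable_predicted_mean.
have mfm t : measurable_fun setT (fm t) by exact: measurable_filtered_mean.
have pR t : gaussian_residual P (past_outputs y t) (x t) (pm t) (pc t).
  exact: (predicted_residual _ _ _ _ _ _ A B C Sx0 Sw Sv x0 w v g x u y).
have fR t : gaussian_residual P (outputs y t) (x t) (fm t) (fc t).
  exact: (filtered_residual _ _ _ _ _ _ A B C Sx0 Sw Sv x0 w v g x u y).
have pRS t : gaussian_residual P (outputs y t) (x t.+1) (pm t.+1) (pc t.+1) by exact: pR.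
have pc_pos t : posdef (pc t.+1).
  have [k [M [MM _]]] := fR t; rewrite /pc /= -/(fc t) -MM.
  rewrite (_ : A *m (M *m M^T) *m A^T = (A *m M) *m (A *m M)^T).
    exact: posdef_gramD.
  by rewrite trmx_mul !mulmxA.
have fc_pos t : (t = 0%N -> posdef Sx0) -> posdef (fc t).
  move=> h; apply: posdef_update_cov => //.
  by case: t h => [/(_ erefl)|t _] //; exact: pc_pos.
split.
- move=> t; split; first exact: (residual_has_cond_moments (mO t) (mX t) (mfm t) (fR t)).
  exact: (residual_has_cond_moments (mO t) (mX t.+1) (mpm t.+1) (pRS t)).
- move=> t /fc_pos fp; split; last exact: (residual_cond_density (mO t) (mX t) (mfm t) (fR t)).
  have := residual_cond_cov (mO t) (mX t) (mfm t) (fR t).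
  by apply: filterS => om; rewrite /Pcov => ->.
- move=> t; split; last exact: (residual_cond_density (mO t) (mX t.+1) (mpm t.+1) (pRS t)).
  have := residual_cond_cov (mO t) (mX t.+1) (mpm t.+1) (pRS t).
  by apply: filterS => om; rewrite /Pcov => ->.
- have := residual_cond_mean (mO 0%N) (mX 0%N) (mfm 0%N) (fR 0%N).
  have := residual_cond_cov (mO 0%N) (mX 0%N) (mfm 0%N) (fR 0%N).
  apply: filterS2 => om; rewrite /xhat /Pcov => -> ->; split => //.
  by rewrite outputsE /fm /filtered_mean last_snoc_mx.
move=> t.
have fmE := residual_cond_mean (mO t) (mX t) (mfm t) (fR t).
have fcE := residual_cond_cov (mO t) (mX t) (mfm t) (fR t).
have pmE := residual_cond_mean (mO t) (mX t.+1) (mpm t.+1) (pRS t).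
have pcE := residual_cond_cov (mO t) (mX t.+1) (mpm t.+1) (pRS t).
have fmSE := residual_cond_mean (mO t.+1) (mX t.+1) (mfm t.+1) (fR t.+1).
have fcSE := residual_cond_cov (mO t.+1) (mX t.+1) (mfm t.+1) (fR t.+1).
apply: filterS (filterI fmE (filterI fcE (filterI pmE (filterI pcE
  (filterI fmSE fcSE))))) => om [E1 [E2 [E3 [E4 [E5 E6]]]]].
rewrite /xhat /Pcov E1 E2 E3 E4 E5 E6; split => //.
by rewrite outputsE /fm /filtered_mean init_snoc_mx last_snoc_mx.
Qed.
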